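(* Suppose the labeled $n$-dimensional unoriented grid satisfies the following assumption: for every port $\ell\in\{1,\dots,2n\}$, every positive integer $z$, and every sequence of cells $c_0,\dots,c_z$ such that for each $0\le j\le z-1$ the cell $c_{j+1}$ is reached by leaving $c_j$ via port $\ell$, we have $c_0\neq c_z$. Then, for every positive integer $n$, $3$ agents governed by deterministic finite automata in the synchronous model suffice to explore any such $n$-dimensional unoriented grid, and $4$ such agents suffice in the semi-synchronous model.
   Context: The $n$-dimensional grid has vertex set (cells) $\mathbb{Z}^n$; two cells are adjacent if they differ by exactly $1$ in exactly one coordinate. In the unoriented grid, each endpoint of each edge carries a label (port) from $\{1,\dots,2n\}$ such that at each cell the $2n$ incident edges carry pairwise distinct labels at that cell; no other consistency between labels of different cells is assumed. There are $m$ agents, all initially in the same cell (the origin); agents cannot distinguish cells. Each agent is governed by the same deterministic finite automaton with finite state set $Q$ (agents may start in different initial states). In each look-compute-move cycle, an agent in state $q$ observes the set of states of agents in its cell and, for each port of its cell, the label at the other endpoint of the corresponding edge; based on this it moves to a new state and either leaves the cell via a chosen port or stays. Time proceeds in discrete steps; each active agent performs one atomic cycle per step. In the synchronous model all agents are active in every step; in the semi-synchronous model an adversary chooses in each step an arbitrary subset of active agents, subject to each agent being active infinitely often. The grid is explored if every cell is eventually visited by some agent (for every admissible schedule in the semi-synchronous model). *)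

(* Defs.v *)
From HB Require Import structures.
From mathcomp Require Import all_boot all_order all_algebra.
Set Implicit Arguments. Unset Strict Implicit. Unset Printing Implicit Defensive.

Definition cell (n : nat) := {ffun 'I_n -> int}.
(* Ports {1,...,2n} are represented by 'I_(2*n) = {0,...,2n-1}. *)
Definition port (n : nat) := 'I_(2 * n).
(* Geometric directions: (coordinate, sign) ; true = +1, false = -1. *)
Definition dir (n : nat) := ('I_n * bool)%type.

Definition origin (n : nat) : cell n := [ffun _ => 0%R].

Definition neighbor (n : nat) (c : cell n) (d : dir n) : cell n :=
  [ffun k => (c k + (if k == d.1 then (if d.2 then 1 else -1) else 0))%R].

Definition opp_dir (n : nat) (d : dir n) : dir n := (d.1, ~~ d.2).

(* A port labeling of the unoriented grid: at every cell, a bijection between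
   the ports and the 2n incident edges (identified by their direction). *)
Record labeling (n : nat) := Labeling {
  port_dir : cell n -> port n -> dir n;
  dir_port : cell n -> dir n -> port n;
  port_dirK : forall c, cancel (port_dir c) (dir_port c);
  dir_portK : forall c, cancel (dir_port c) (port_dir c) }.

Definition leave (n : nat) (L : labeling n) (c : cell n) (p : port n) : cell n :=
  neighbor c (port_dir L c p).

Definition far_label (n : nat) (L : labeling n) (c : cell n) (p : port n) : port n :=
  dir_port L (leave L c p) (opp_dir (port_dir L c p)).

Definition no_port_cycle (n : nat) (L : labeling n) : Prop :=
  forall (l : port n) (z : nat) (cs : nat -> cell n), 0 < z ->
    (forall j, j < z -> cs j.+1 = leave L (cs j) l) -> cs 0 <> cs z.

(* Transition function of a deterministic finite automaton with state set Q:
   (own state, set of states in the cell, far labels of every port)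
   |-> (new state, None = stay / Some p = leave via port p). *)
Definition transition (n : nat) (Q : finType) :=
  Q -> {set Q} -> {ffun port n -> port n} -> Q * option (port n).

Record config (n m : nat) (Q : finType) := Config {
  cpos : 'I_m -> cell n;
  cst : 'I_m -> Q }.

Definition obs_states (n m : nat) (Q : finType) (cf : config n m Q) (i : 'I_m)
  : {set Q} := [set cst cf j | j : 'I_m & cpos cf j == cpos cf i].

Definition obs_ports (n : nat) (L : labeling n) (c : cell n)
  : {ffun port n -> port n} := [ffun p => far_label L c p].

Definition step (n m : nat) (Q : finType) (L : labeling n) (delta : transition n Q)
  (A : {set 'I_m}) (cf : config n m Q) : config n m Q :=
  let act i := delta (cst cf i) (obs_states cf i) (obs_ports L (cpos cf i)) in
  @Config n m Q
    (fun i => if i \in A then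
                match (act i).2 with
                | Some p => leave L (cpos cf i) p
                | None => cpos cf i
                end
              else cpos cf i)
    (fun i => if i \in A then (act i).1 else cst cf i).

Fixpoint run (n m : nat) (Q : finType) (L : labeling n) (delta : transition n Q)
  (init : 'I_m -> Q) (sched : nat -> {set 'I_m}) (t : nat) : config n m Q :=
  match t with
  | 0 => @Config n m Q (fun _ => origin n) init
  | t'.+1 => step L delta (sched t') (run L delta init sched t')
  end.

Definition explores (n m : nat) (Q : finType) (L : labeling n) (delta : transition n Q)
  (init : 'I_m -> Q) (sched : nat -> {set 'I_m}) : Prop :=
  forall c : cell n, exists t, exists i : 'I_m, cpos (run L delta init sched t) i = c.

Definition fair (m : nat) (sched : nat -> {set 'I_m}) : Prop :=
  forall (i : 'I_m) (t : nat), exists2 t', t <= t' & i \in sched t'.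

Definition sync_sched (m : nat) : nat -> {set 'I_m} := fun _ => setT.

(* Main.v *)
Require Import Defs.
From mathcomp Require Import all_boot all_order all_algebra.
From HB Require Import structures.
From mathcomp Require Import zify.

(* The edges {c, leave c 0} form a forest whose trees are infinite because no
   path along port 0 closes up.  An automaton that has just entered a cell can
   follow the Euler tour of its tree, forwards or backwards, from the far
   labels alone, and the tour never repeats an oriented edge.  So every cell x
   starts a ray X_0, X_1, ... of positions, and one agent at x together with
   one at X_k stores the number k.

   A team realizes the operation (x, k) -> (y, k a / d), with y = x or y a
   neighbor of x, where a, d and y depend on k modulo a constant and on the
   labels seen from x.  Three synchronous agents do it by timing: from X_k one
   agent returns to x at speed 1 and goes on along the ray of y at speed
   1/(d+1), the other returns at speed 1/(a+1) and then chases it at speed 1;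
   they meet at distance k a / d.  Four semi-synchronous agents do it by
   pulling one agent d steps towards x for every a steps that another one is
   pushed along the ray of y.

   With such operations k = p^X q^Y encodes two stacks of ports: X a word still
   to be followed, Y the way back.  Popping a port from one stack, leaving
   through it and pushing the far label on the other is undone by the same
   step with the stacks exchanged, so the team goes from the origin along
   every finite word and back. *)
Set Implicit Arguments. Unset Strict Implicit. Unset Printing Implicit Defensive.

(** * The Euler tour of a port tree *)

Section Line.
Variables (n : nat) (hn : 0 < n).

Definition view := {ffun port n -> port n}.

Lemma port0_proof : 0 < 2 * n.
Proof. by rewrite muln_gt0. Qed.
Definition port0 : port n := Ordinal port0_proof.

(** The edge behind [p] belongs to the forest iff one of its two end labels is [port0], so the cells
    at both ends agree on it. *)
Definition tree_port (g : view) (p : port n) := (p == port0) || (g p == port0).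
Definition tree_ports (g : view) := enum [pred p | tree_port g p].
Definition nxt (g : view) (q : port n) := next (tree_ports g) q.
Definition prv (g : view) (p : port n) := prev (tree_ports g) p.

Lemma nxtK g : cancel (nxt g) (prv g).
Proof. exact/prev_next/enum_uniq. Qed.

Lemma tree_port_nxt g q : tree_port g (nxt g q) = tree_port g q.
Proof. by have := mem_next (tree_ports g) q; rewrite !mem_enum. Qed.

Variable L : labeling n.

Lemma leave_far c p : leave L (leave L c p) (far_label L c p) = c.
Proof.
rewrite {1}/leave /far_label dir_portK /leave.
case: (port_dir L c p) => i s; apply/ffunP => k; rewrite !ffunE /=.
by case: eqP => _; case: s; rewrite ?GRing.addr0 ?GRing.addrK ?GRing.addrNK.
Qed.

Lemma far_far c p : far_label L (leave L c p) (far_label L c p) = p.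
Proof.
rewrite {1}/far_label leave_far /far_label dir_portK /opp_dir /= negbK.
by rewrite -surjective_pairing port_dirK.
Qed.

Lemma neighbor_neq (c : cell n) d : neighbor c d != c.
Proof.
apply/eqP => /ffunP /(_ d.1); rewrite !ffunE eqxx => /eqP.
by rewrite -GRing.subr_eq0 GRing.addrC GRing.addKr; case: d.2.
Qed.

Lemma leave_neq c p : leave L c p != c.
Proof. exact: neighbor_neq. Qed.

(* A position on a tour is a cell together with the port by which it was
   entered. *)
Definition out (z : cell n * port n) := nxt (obs_ports L z.1) z.2.
Definition fwd (z : cell n * port n) : cell n * port n :=
  (leave L z.1 (out z), far_label L z.1 (out z)).
Definition line (x : cell n) (i : nat) := iter i fwd (x, port0).

Lemma leave_fwd z : leave L (fwd z).1 (fwd z).2 = z.1.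
Proof. exact: leave_far. Qed.

Lemma far_fwd z : far_label L (fwd z).1 (fwd z).2 = out z.
Proof. exact: far_far. Qed.

(** [leave_fwd] and [far_fwd] recover the previous cell and the port by which it was left; the
    previous entry port follows since [nxt] is injective. *)
Lemma fwd_inj : injective fwd.
Proof.
move=> z w e; have ec : z.1 = w.1 by rewrite -leave_fwd e leave_fwd.
have eo : out z = out w by rewrite -far_fwd e far_fwd.
move: eo; rewrite /out ec => /(can_inj (nxtK _)).
by move: ec; case: (z); case: (w) => ? ? ? ? /= -> ->.
Qed.

Definition on_tree (z : cell n * port n) := tree_port (obs_ports L z.1) z.2.

Lemma on_tree_fwd z : on_tree z -> on_tree (fwd z).
Proof.
rewrite /on_tree -tree_port_nxt -/(out z) /tree_port !ffunE /= far_far.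
by rewrite orbC.
Qed.

Lemma on_tree_line x i : on_tree (line x i).
Proof.
elim: i => [|i IH] /=; first by rewrite /on_tree /tree_port eqxx.
exact: on_tree_fwd.
Qed.

Hypothesis nc : no_port_cycle L.

Let parent c := leave L c port0.

Lemma parent_acyclic j c : iter j parent c = c -> j = 0.
Proof.
by case: j => // j e; case: (@nc port0 j.+1 (fun i => iter i parent c)).
Qed.

Let below u w := exists j, iter j parent w = u.

Lemma not_below_parent u : ~ below u (parent u).
Proof. by case=> j; rewrite -iterSr => /parent_acyclic. Qed.

(** A forest edge whose near label is not [port0] has far label [port0]: the tour descends to a
    child, entering it through the child's own parent edge. *)
Lemma child_parent z : on_tree z -> out z != port0 ->
  parent (fwd z).1 = z.1 /\ (fwd z).2 = port0.
Proof.
rewrite /on_tree -tree_port_nxt -/(out z) /tree_port ffunE.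
move=> /orP[/eqP ->|/eqP e _]; first by rewrite eqxx.
have e2 : (fwd z).2 = port0 by exact: e.
by split=> //; rewrite -[RHS]leave_fwd e2.
Qed.

(* Unless the tour leaves [u] through the edge to its parent, it stays in the
   subtree below [u]. *)
Lemma below_fwd u z : on_tree z -> below u z.1 ->
  ~~ ((z.1 == u) && (out z == port0)) -> below u (fwd z).1.
Proof.
move=> tz [j ej]; case: (eqVneq (out z) port0) => [eo | no _].
  rewrite andbT; case: j ej => [|j]; first by move=> /= -> /eqP.
  by rewrite iterSr => ej _; exists j; rewrite /= eo.
by have [ep _] := child_parent tz no; exists j.+1; rewrite iterSr ep.
Qed.

(** * Aperiodicity of the tour *)

Section Orbit.
Variables (x : cell n) (m : nat).
Hypotheses (m_gt0 : 0 < m) (per : line x m = line x 0).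

Let orb z := exists j, z = line x j.

Lemma orb_fwd z : orb z -> orb (fwd z).
Proof. by case=> j ->; exists j.+1. Qed.

Lemma orb_iter i z : orb z -> orb (iter i fwd z).
Proof. by move=> oz; elim: i => //= i /orb_fwd. Qed.

Lemma orb_period z : orb z -> iter m fwd z = z.
Proof. by case=> j ->; rewrite /line -iterD addnC iterD; congr iter. Qed.

Lemma orb_tree z : orb z -> on_tree z.
Proof. by case=> j ->; exact: on_tree_line. Qed.

(* A periodic tour that came down to [u] from its parent [v] must return to
   [v], hence it leaves the subtree of [u] by the same edge. *)
Lemma orb_up u : orb (u, port0) -> orb (parent u, far_label L u port0).
Proof.
move=> ou; set z := (u, port0).
case: (boolP [exists i : 'I_m,
    ((iter i fwd z).1 == u) && (out (iter i fwd z) == port0)]).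
  case/existsP => i /andP[/eqP eu /eqP eo].
  by have := orb_iter i.+1 ou; rewrite /= /fwd eo eu.
move/existsPn => H.
have D i : i < m -> below u (iter i fwd z).1.
  elim: i => [|i IH] lt; first by exists 0.
  apply: below_fwd; [exact/orb_tree/orb_iter | exact/IH/ltnW | ].
  exact: (H (Ordinal (ltnW lt))).
have lt : m.-1 < m by rewrite prednK.
have := D _ lt; have := orb_period ou; rewrite -/z -{1}(prednK m_gt0) iterS.
(* By [e] the last position of the period is followed by [(u, port0)], so its cell is [parent u],
   whereas [D] puts it below [u]. *)
move=> e; rewrite -leave_fwd e => /not_below_parent.
by [].
Qed.

(** Some number [i] of rotations of the forest ports leads from [q] to [port0]. By [orb_up] every
    excursion to a child ends back at [v], one rotation further, so induction on [i] applies. *)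
Lemma orb_parent v q : orb (v, q) -> exists q', orb (parent v, q').
Proof.
move=> o; have [i] : exists i, iter i (nxt (obs_ports L v)) q = port0.
  have U := enum_uniq [pred p | tree_port (obs_ports L v) p].
  have T := orb_tree o.
  have/iter_findex e : fconnect (nxt (obs_ports L v)) q port0.
    by rewrite (fconnect_cycle (cycle_next U)) mem_enum.
  by exists (findex (nxt (obs_ports L v)) q port0).
elim: i q o => [|i IH] q o.
  by move=> /= e; rewrite e in o; exists (far_label L v port0); exact: orb_up.
rewrite iterSr => e; have e' : out (v, q) = nxt (obs_ports L v) q by [].
case: (eqVneq (out (v, q)) port0) => [eo | no].
  by have := orb_fwd o; rewrite /fwd eo /=; exists (far_label L v port0).
have [ep e0] := child_parent (orb_tree o) no.
have : orb ((fwd (v, q)).1, port0).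
  by have := orb_fwd o; rewrite [fwd (v, q)]surjective_pairing e0.
move/orb_up; rewrite ep => h; apply: (IH _ _ e); move: h.
by rewrite -e0 far_fwd e'.
Qed.

(** A tour of period [m] has at most [m] cells, but by [orb_parent] it contains [m + 1] ancestors of
    [x], which are distinct by [parent_acyclic]. *)
Lemma line_aperiodic : False.
Proof.
pose s1 := [seq iter j parent x | j <- iota 0 m.+1].
pose s2 := [seq (line x j).1 | j <- iota 0 m].
have: size s1 <= size s2.
  apply: uniq_leq_size.
    rewrite map_inj_in_uniq ?iota_uniq // => i j _ _.
    wlog le: i j / i <= j.
      by move=> W e; case/orP: (leq_total i j) => h; [|symmetry]; apply: W.
    rewrite -(subnK le) iterD => /esym /parent_acyclic.
    by move=> ->.
  move=> c /mapP[j _ ->].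
  have [q [i]] : exists q, orb (iter j parent x, q).
    elim: j => [|j [q /orb_parent]] //=; by exists port0, 0.
  move=> e; apply/mapP; exists (i %% m); first by rewrite mem_iota ltn_mod.
  have -> : line x (i %% m) = line x i.
    rewrite {2}(divn_eq i m); elim: (i %/ m) => [|a IH] //.
    rewrite mulSn -addnA addnC {2}/line iterD -/(line x m) per.
    by rewrite -iterD addn0.
  by rewrite -e.
by rewrite !size_map !size_iota ltnn.
Qed.

End Orbit.

(** As [fwd] is injective, a coincidence at [i <= j] pulls back to index 0, where a positive [j - i]
    would be a period. *)
Lemma line_inj x : injective (line x).
Proof.
move=> i j; wlog le: i j / i <= j.
  by move=> W e; case/orP: (leq_total i j) => h; [|symmetry]; apply: W.
move=> e; have : line x (j - i) = line x 0.
  elim: i j le e => [|i IH] [|j] // le e.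
  by apply: IH => //; exact: fwd_inj.
case: (posnP (j - i)) => [|lt /(line_aperiodic lt)] //.
by move/eqP; rewrite subn_eq0 => le' _; apply/eqP; rewrite eqn_leq le.
Qed.

Lemma obs_portsE c p : obs_ports L c p = far_label L c p.
Proof. by rewrite ffunE. Qed.

Lemma prv_out x i : prv (obs_ports L (line x i).1) (out (line x i)) = (line x i).2.
Proof. exact: nxtK. Qed.

Lemma leave_line x i : leave L (line x i.+1).1 (line x i.+1).2 = (line x i).1.
Proof. exact: leave_fwd. Qed.

Lemma far_line x i : obs_ports L (line x i.+1).1 (line x i.+1).2 = out (line x i).
Proof. by rewrite obs_portsE; exact: far_fwd. Qed.

(** The tour may pass through the cell [x] again; the port of departure singles out index 0. This is
    how an agent coming backwards recognizes the base. *)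
Lemma line_base x i :
  (x == (line x i).1) && (out (line x i) == nxt (obs_ports L (line x i).1) port0)
  = (i == 0).
Proof.
apply/andP/eqP => [[/eqP ex /eqP eo]|-> /=]; last by rewrite !eqxx.
apply: (line_inj (x := x)); rewrite [LHS]surjective_pairing -ex /=.
by congr (_, _); apply: (can_inj (nxtK (obs_ports L (line x i).1))).
Qed.

Lemma line_eq x i j :
  (line x i).1 = (line x j).1 -> (line x i).2 = (line x j).2 -> i = j.
Proof.
move=> e1 e2; apply: (line_inj (x := x)).
by rewrite [LHS]surjective_pairing e1 e2 -surjective_pairing.
Qed.
End Line.

(** * Reachability by iteration *)

Definition reach (T : Type) (f : T -> T) (x y : T) := exists m, iter m f x = y.

Lemma reach_refl T (f : T -> T) x : reach f x x.
Proof. by exists 0. Qed.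

Lemma reach_trans T (f : T -> T) y x z :
  reach f x y -> reach f y z -> reach f x z.
Proof. by move=> [i <-] [j <-]; exists (j + i); rewrite iterD. Qed.

Lemma reach_step T (f : T -> T) x y : reach f (f x) y -> reach f x y.
Proof. by apply: reach_trans; exists 1. Qed.

(** * Machines with a movable base and one counter *)

Section Machine.
Variables (n : nat) (S : finType) (md : nat).
Variable op : S -> view n -> nat -> S * (nat * nat) * option (port n).

(* All that determines a step: the control state, the far labels seen from the
   base, and the residue of the counter. *)
Definition ctx := (S * view n * 'I_md.+1)%type.
Definition ctx_op (c : ctx) := op c.1.1 c.1.2 c.2.
Definition ctx_next c := (ctx_op c).1.1.
Definition ctx_num c := (ctx_op c).1.2.1.
Definition ctx_den c := (ctx_op c).1.2.2.
Definition ctx_move c := (ctx_op c).2.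

(** The bounds make waiting counters finite. [den_dvdn] makes the division in [mstep] exact,
    although the operation sees only a residue of the counter. *)
Record admissible (K : nat) : Prop := Admissible {
  num_bounds : forall c, 0 < ctx_num c <= K;
  den_bounds : forall c, 0 < ctx_den c <= K;
  den_dvdn : forall s g k, 0 < k -> ctx_den (s, g, inZp k) %| k }.

Variable L : labeling n.

Definition hop (x : cell n) (mv : option (port n)) :=
  if mv is Some p then leave L x p else x.

Definition mstep (z : cell n * nat * S) : cell n * nat * S :=
  let: (x, k, s) := z in
  let c : ctx := (s, obs_ports L x, inZp k) in
  (hop x (ctx_move c), k * ctx_num c %/ ctx_den c, ctx_next c).

Lemma mstepE x k s : mstep (x, k, s) =
  let: (s', (a, d), mv) := op s (obs_ports L x) (k %% md.+1) in
  (hop x mv, k * a %/ d, s').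
Proof.
rewrite /mstep /ctx_move /ctx_num /ctx_den /ctx_next /ctx_op /=.
by case: (op _ _ _) => [[s' [a d]] mv].
Qed.

Lemma mstep_gt0 K z : admissible K -> 0 < z.1.2 -> 0 < (mstep z).1.2.
Proof.
case: z => [[x k] s] [numP denP dvdP] /= k_gt0.
have [a_gt0 _] := andP (numP (s, obs_ports L x, inZp k)).
have [d_gt0 _] := andP (denP (s, obs_ports L x, inZp k)).
by rewrite divn_gt0 // dvdn_leq ?muln_gt0 ?k_gt0 // dvdn_mulr // dvdP.
Qed.

Lemma mstep_simulation K (X : Type) (f : X -> X) (sim : cell n * nat * S -> X -> Prop) :
  admissible K ->
  (forall z T, 0 < z.1.2 -> sim z T -> exists2 T', sim (mstep z) T' & reach f T T') ->
  forall z z' T, 0 < z.1.2 -> sim z T -> reach mstep z z' ->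
  exists2 T', sim z' T' & reach f T T'.
Proof.
move=> op_ok step z z' T z_gt0 zT [m <-].
suff [_ //] : 0 < (iter m mstep z).1.2 /\
  exists2 T', sim (iter m mstep z) T' & reach f T T'.
elim: m => [|m [m_gt0 [T' mT' run]]].
  by split=> //; exists T => //; exact: reach_refl.
split; first exact: mstep_gt0 op_ok m_gt0.
have [T'' mT'' run'] := step _ _ m_gt0 mT'.
by exists T'' => //; exact: reach_trans run run'.
Qed.
End Machine.

Lemma inord_0 K : inord 0 = ord0 :> 'I_K.+1.
Proof. by apply: val_inj; rewrite /= inordK. Qed.

(** * A machine that follows every word of ports *)

Section Walker.
Variables (n : nat) (hn : 0 < n).
Local Notation b := (2 * n).
Local Notation port0 := (port0 hn).

(** Two of the primes carry the stacks, the third is a scratch register. *)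
Definition radix (i : 'I_3) := nth 0 [:: 2; 3; 5] i.

Lemma radix_prime i : prime (radix i).
Proof. by case: i => -[|[|[|]]]. Qed.

Lemma radix_gt0 i : 0 < radix i.
Proof. exact/prime_gt0/radix_prime. Qed.

Lemma radix_inj : injective radix.
Proof.
by move=> [[|[|[|]]] //= ?] [[|[|[|]]] //= ?] //= _; apply: val_inj.
Qed.

(** Since [30 = 2 * 3 * 5], each [radix i ^ e] with [e <= b.+1] divides the modulus, so divisibility
    by it can be read from the residue. The predecessor offsets the successor in the type of
    residues. *)
Definition walker_mod := (30 ^ b.+1).-1.

Lemma dvdn_radix_mod i e : e <= b.+1 -> radix i ^ e %| walker_mod.+1.
Proof.
move=> le; rewrite /walker_mod prednK ?expn_gt0 //.
apply: (@dvdn_trans (radix i ^ b.+1)); first exact: dvdn_exp2l.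
by apply: dvdn_exp2r; case: i => -[|[|[|]]].
Qed.

(* (popping, forward?, (i, j, l)): the counter is [radix i ^ X * radix j ^ Y],
   with [X] the stack being popped and [Y] the one being pushed; [l] is free.
   A pop replaces [X = d.+1 + b * X'] by [X'], kept as the exponent of [l], and
   reuses [radix i] for the new [Y]; the three radices then rotate. *)
Definition walker_state := (bool * bool * ('I_3 * 'I_3 * 'I_3))%type.

(** An empty popped stack causes a turn. A turn with [dir] false, made back at the start, also
    multiplies by [q]: this adds 1 to the code of the word just retraced, so words are followed in
    the order of their codes. *)
Definition walker_op (s : walker_state) (g : view n) (r : nat)
    : walker_state * (nat * nat) * option (port n) :=
  let: (popping, dir, (i, j, l)) := s in
  let: (p, q, t) := (radix i, radix j, radix l) in
  if popping then
    if ~~ (p %| r) then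
      ((true, ~~ dir, (j, i, l)), (if dir then 1 else q, 1), None)
    else if p ^ b.+1 %| r then (s, (t, p ^ b), None)
    else let d := insubd port0 (logn p r).-1 in
      ((false, dir, (i, j, l)), (p ^ g d, p ^ d), Some d)
  else if q %| r then (s, (p ^ b, q), None)
  else ((true, dir, (l, i, j)), (1, 1), None).

Lemma walker_op_pos s g r :
  0 < (walker_op s g r).1.2.1 /\ 0 < (walker_op s g r).1.2.2.
Proof.
case: s => [[ph dir] [[i j] l]] /=.
by do ![case: ifP => _ //=]; rewrite ?expn_gt0 ?radix_gt0.
Qed.

Lemma leq_radix_exp i e m : e <= m.+1 -> radix i ^ e <= 5 ^ m.+1.
Proof.
move=> le; apply: (@leq_trans (5 ^ e)); last by rewrite leq_exp2l.
by case: e {le} => // e; rewrite leq_exp2r //; case: i => -[|[|[|]]].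
Qed.

Lemma walker_op_max s g r :
  (walker_op s g r).1.2.1 <= 5 ^ b.+1 /\ (walker_op s g r).1.2.2 <= 5 ^ b.+1.
Proof.
case: s => [[ph dir] [[i j] l]] /=.
have R1 i' : radix i' <= 5 ^ b.+1.
  by have := @leq_radix_exp i' 1 b; rewrite expn1; apply.
have H1 : 0 < 5 ^ b.+1 by rewrite expn_gt0.
have W (m : port n) : m <= b.+1 by rewrite ltnW // ltnW // !ltnS.
by do ![case: ifP => _ //=]; split; rewrite // leq_radix_exp.
Qed.

Lemma walker_op_dvd s g k : 0 < k ->
  (walker_op s g (k %% walker_mod.+1)).1.2.2 %| k.
Proof.
move=> k_gt0; case: s => [[ph dir] [[i j] l]] /=.
have D i' e : e <= b.+1 -> radix i' ^ e %| k %% walker_mod.+1 -> radix i' ^ e %| k.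
  by move=> le; rewrite /dvdn modn_dvdm // dvdn_radix_mod.
case: ifP => _; last first.
  by case: ifP => //= h; have := D j 1; rewrite expn1; apply.
case: ifP => //= /negbFE h; case: ifP => /= [|/negbT] h2.
  by apply: D => //; apply: dvdn_trans h2; apply: dvdn_exp2l.
apply: D; first by rewrite ltnW // ltnW // !ltnS.
apply: (@dvdn_trans (radix i ^ (logn (radix i) (k %% walker_mod.+1)))).
  apply: dvdn_exp2l; rewrite /insubd.
  by case: insubP => /= [? _ -> |_]; rewrite ?leq_pred.
exact: pfactor_dvdnn.
Qed.

Definition stacks (i j l : 'I_3) X Y Z := radix i ^ X * radix j ^ Y * radix l ^ Z.

Lemma uniq_swap (i j l : 'I_3) : uniq [:: i; j; l] -> uniq [:: j; i; l].
Proof. by rewrite (perm_uniq (permEl (perm_catCA [:: i] [:: j] [:: l]))). Qed.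

Lemma uniq_rotate (i j l : 'I_3) : uniq [:: i; j; l] -> uniq [:: l; i; j].
Proof. by rewrite -(rot_uniq 1 [:: l; i; j]). Qed.

Lemma stacks_gt0 i j l X Y Z : 0 < stacks i j l X Y Z.
Proof. by rewrite !muln_gt0 !expn_gt0 !radix_gt0. Qed.

Lemma stacksC i j l X Y Z : stacks i j l X Y Z = stacks j i l Y X Z.
Proof. by rewrite /stacks [_ ^ X * _]mulnC. Qed.

Lemma logn_stacks i j l X Y Z : uniq [:: i; j; l] ->
  logn (radix i) (stacks i j l X Y Z) = X.
Proof.
rewrite /= !inE negb_or => /and3P[/andP[ij il] _ _].
rewrite !lognM ?muln_gt0 ?expn_gt0 ?radix_gt0 // !lognX.
rewrite !logn_prime ?radix_prime // eqxx !(inj_eq radix_inj).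
by rewrite (negbTE ij) (negbTE il) !muln0 !addn0 muln1.
Qed.

Lemma dvdn_stacks i j l X Y Z e : uniq [:: i; j; l] -> e <= b.+1 ->
  (radix i ^ e %| stacks i j l X Y Z %% walker_mod.+1) = (e <= X).
Proof.
move=> u le; rewrite /dvdn modn_dvdm ?dvdn_radix_mod // -/(dvdn _ _).
by rewrite pfactor_dvdn ?radix_prime ?stacks_gt0 // logn_stacks.
Qed.

Lemma logn_stacks_mod i j l X Y Z : uniq [:: i; j; l] -> X <= b ->
  logn (radix i) (stacks i j l X Y Z %% walker_mod.+1) = X.
Proof.
move=> u le; set r := _ %% _.
have h1 : radix i ^ X %| r by rewrite dvdn_stacks // leqW.
have h2 : ~~ (radix i ^ X.+1 %| r) by rewrite dvdn_stacks // ltnn.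
have r_gt0 : 0 < r by case: posnP h2 => // ->; rewrite dvdn0.
apply/eqP; rewrite eqn_leq; move: h1 h2.
by rewrite !pfactor_dvdn ?radix_prime // -leqNgt => -> ->.
Qed.

Lemma walker_admissible : admissible walker_mod walker_op (5 ^ b.+1).
Proof.
split=> [[[s g] r]|[[s g] r]|s g k k_gt0]; last exact: (walker_op_dvd s g k_gt0).
  by apply/andP; split; [case: (walker_op_pos s g r) | case: (walker_op_max s g r)].
by apply/andP; split; [case: (walker_op_pos s g r) | case: (walker_op_max s g r)].
Qed.

Variable L : labeling n.
Local Notation walk := (reach (mstep walker_mod walker_op L)).

(** As [0 < X], the exponent exceeds [b] while [a] is positive, so each round can trade
    [radix i ^ b] for one [radix l]. *)
Lemma walk_divide x i j l X Y Z a dir : uniq [:: i; j; l] -> 0 < X ->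
  walk (x, stacks i j l (X + b * a) Y Z, (true, dir, (i, j, l)))
       (x, stacks i j l X Y (Z + a), (true, dir, (i, j, l))).
Proof.
move=> u X_gt0; elim: a Z => [|a IH] Z.
  by rewrite muln0 !addn0; exact: reach_refl.
apply: reach_step; rewrite addnS -addSn.
have := IH Z.+1; congr (walk _ _); rewrite mstepE /=.
have := @dvdn_stacks i j l (X + b * a.+1) Y Z 1 u isT.
rewrite expn1 => ->; rewrite addn_gt0 X_gt0 /=.
rewrite dvdn_stacks // (_ : b < _) /=; last first.
  by rewrite mulnS; lia.
congr (_, _, _); apply/esym/eqP.
rewrite -(eqn_pmul2r (m := radix i ^ b)) ?expn_gt0 ?radix_gt0 //.
rewrite divnK; last first.
  by rewrite /stacks mulnS addnCA expnD -!mulnA dvdn_mulr.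
by apply/eqP; rewrite /stacks mulnS addnCA !expnD expnS; lia.
Qed.

Lemma walk_move x i j l Y Z dir (d : port n) : uniq [:: i; j; l] ->
  walk (x, stacks i j l d.+1 Y Z, (true, dir, (i, j, l)))
       (leave L x d, stacks i j l (far_label L x d).+1 Y Z, (false, dir, (i, j, l))).
Proof.
move=> u; exists 1; rewrite -[iter _ _ _]/(mstep _ _ _ (_, _, _)) mstepE /=.
have := @dvdn_stacks i j l d.+1 Y Z 1 u isT; rewrite expn1 => -> /=.
rewrite dvdn_stacks // [b < _]ltnNge ltn_ord /=.
rewrite logn_stacks_mod //= /insubd valK /= ffunE.
congr (_, _, _); apply/eqP.
rewrite -(eqn_pmul2r (m := radix i ^ d)) ?expn_gt0 ?radix_gt0 //.
rewrite divnK; last by rewrite /stacks expnS -!mulnA dvdn_mull // dvdn_mulr.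
by rewrite /stacks !expnS; apply/eqP; lia.
Qed.

Lemma walk_multiply x i j l X Y Z dir : uniq [:: i; j; l] ->
  walk (x, stacks i j l X Y Z, (false, dir, (i, j, l)))
       (x, stacks i j l (X + b * Y) 0 Z, (true, dir, (l, i, j))).
Proof.
move=> u; have u' := uniq_swap u.
have D X' Y' : (radix j %| stacks i j l X' Y' Z %% walker_mod.+1) = (0 < Y').
  by rewrite stacksC -{1}(expn1 (radix j)) dvdn_stacks.
elim: Y X => [|Y IH] X; apply: reach_step; rewrite mstepE /= D /=.
  by rewrite muln0 addn0 muln1 divn1; exact: reach_refl.
rewrite (_ : _ %/ _ = stacks i j l (X + b) Y Z).
  by have := IH (X + b); rewrite mulnS addnA.
apply/eqP; rewrite -(eqn_pmul2r (m := radix j)) ?radix_gt0 // divnK.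
  by rewrite /stacks !expnD expnS; apply/eqP; lia.
by rewrite /stacks expnS -!mulnA dvdn_mull // dvdn_mulr.
Qed.

Lemma walk_turn x i j l Y dir : uniq [:: i; j; l] ->
  walk (x, stacks i j l 0 Y 0, (true, dir, (i, j, l)))
       (x, stacks j i l (Y + ~~ dir) 0 0, (true, ~~ dir, (j, i, l))).
Proof.
move=> u; exists 1; rewrite -[iter _ _ _]/(mstep _ _ _ (_, _, _)) mstepE /=.
have := @dvdn_stacks i j l 0 Y 0 1 u isT; rewrite expn1 => -> /=.
congr (_, _, _); rewrite divn1 stacksC; case: dir; rewrite /stacks ?addn0 ?muln1 //=.
by rewrite addn1 expnS mulnC.
Qed.

(* Bijective base-[b] numeration: 0 encodes only the empty word. *)
Fixpoint word_code (w : seq (port n)) :=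
  if w is d :: w' then (d.+1 + b * word_code w')%N else 0.

Lemma word_code_surj N : exists w, word_code w = N.
Proof.
elim/ltn_ind: N => -[|N] IH; first by exists [::].
have b_gt0 := port0_proof hn.
have [|w ew] := IH (N %/ b); first by rewrite ltnS leq_div.
exists (Ordinal (ltn_pmod N b_gt0) :: w) => /=.
by rewrite ew addSn addnC mulnC -divn_eq.
Qed.

Definition walker_at x dir w v (z : cell n * nat * walker_state) :=
  exists i j l, uniq [:: i; j; l] /\
  z = (x, stacks i j l (word_code w) (word_code v) 0, (true, dir, (i, j, l))).

Lemma walker_pop x dir d w v z : walker_at x dir (d :: w) v z ->
  exists2 z', walk z z' & walker_at (leave L x d) dir w (far_label L x d :: v) z'.
Proof.
case=> i [j [l [u ->]]]; eexists; last first.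
  by exists l, i, j; split=> //; exact: uniq_rotate.
apply: (reach_trans (@walk_divide x i j l d.+1 (word_code v) 0 (word_code w) dir u isT)).
apply: (reach_trans (walk_move x (word_code v) _ dir d u)).
apply: (reach_trans (walk_multiply _ _ _ _ _ u)).
by rewrite /stacks add0n !expn0 !muln1 mulnC; exact: reach_refl.
Qed.

Fixpoint follow x (w : seq (port n)) :=
  if w is d :: w' then follow (leave L x d) w' else x.

Lemma follow_cat x w v : follow x (w ++ v) = follow (follow x w) v.
Proof. by elim: w x => //=. Qed.

(** [u] collects the far labels on top of [v]. With the stacks exchanged the same pops retrace the
    path, by [leave_far] and [far_far], and rebuild [w]. *)
Lemma walker_forth x dir w v z : walker_at x dir w v z ->
  exists z' u, [/\ walk z z', walker_at (follow x w) dir [::] u z' &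
    forall dir' y, walker_at (follow x w) dir' u [::] y ->
      exists2 y', walk y y' & walker_at x dir' v w y'].
Proof.
elim: w x v z => [|d w IH] x v z Hz.
  exists z, v; split=> //; first exact: reach_refl.
  by move=> dir' y Hy; exists y => //; exact: reach_refl.
have [z1 zz1 /IH[z2 [u [z12 Hz2 back]]]] := walker_pop Hz.
exists z2, u; split=> //; first exact: reach_trans zz1 z12.
move=> dir' y /back[y1 yy1 /walker_pop[y2 y12]].
by rewrite leave_far far_far => Hy2; exists y2 => //; exact: reach_trans yy1 y12.
Qed.

Lemma walker_turn_forth x v z : walker_at x true [::] v z ->
  exists2 z', walk z z' & walker_at x false v [::] z'.
Proof.
case=> i [j [l [u ->]]]; eexists; first exact: walk_turn.
by exists j, i, l; split; [exact: uniq_swap | rewrite addn0].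
Qed.

Lemma walker_turn_back x v w z : word_code w = (word_code v).+1 ->
  walker_at x false [::] v z -> exists2 z', walk z z' & walker_at x true w [::] z'.
Proof.
move=> e [i [j [l [u ->]]]]; eexists; first exact: walk_turn.
by exists j, i, l; split; [exact: uniq_swap | rewrite e addn1].
Qed.

Lemma walker_visits x z w : walker_at x false [::] [::] z ->
  exists2 z', walk z z' & z'.1.1 = follow x w.
Proof.
move=> Hz; case ew: (word_code w) => [|N].
  exists z; first exact: reach_refl.
  by case: w ew => //= _; case: Hz => i [j [l [_ ->]]].
(* Each round turns at [x], follows the word of the next code, turns and retraces it, which leaves
   that word on the pushed stack. *)
have [z1 [v [zz1 Hz1 ev]]] : exists z1 v,
    [/\ walk z z1, walker_at x false [::] v z1 & word_code v = N].
  elim: N {w ew} => [|N [z1 [v [zz1 Hz1 ev]]]].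
    by exists z, [::]; split=> //; exact: reach_refl.
  have [w ew] := word_code_surj N.+1.
  have [|z2 z12 Hz2] := walker_turn_back (w := w) _ Hz1; first by rewrite ew ev.
  have [z3 [u [z23 Hz3 back]]] := walker_forth Hz2.
  have [z4 z34 /back[z5 z45 Hz5]] := walker_turn_forth Hz3.
  exists z5, w; split=> //; apply: reach_trans zz1 _; apply: reach_trans z12 _.
  by apply: reach_trans z23 _; apply: reach_trans z34 _.
have [|z2 z12 Hz2] := walker_turn_back (w := w) _ Hz1; first by rewrite ew ev.
have [z3 [u [z23 Hz3 back]]] := walker_forth Hz2.
exists z3; first by apply: reach_trans zz1 _; apply: reach_trans z12 _.
by case: Hz3 => i [j [l [_ ->]]].
Qed.

Lemma follow_surj c : exists w, follow (origin n) w = c.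
Proof.
have [m] : exists m, \sum_k `|c k|%N <= m by eexists.
elim: m c => [|m IH] c le.
  exists [::]; apply/ffunP => k /=; rewrite ffunE; apply/esym/eqP.
  by move: le; rewrite leqn0 sum_nat_eq0 => /forallP/(_ k)/=; rewrite absz_eq0.
case: (boolP [exists k, c k != 0%R]) => [/existsP[k ck]|/existsPn H]; last first.
  apply: IH; rewrite big1 // => k _; apply/eqP; rewrite absz_eq0.
  by have := H k; rewrite negbK.
(* [d] moves coordinate [k] one step towards 0, which lowers the sum of absolute values. *)
pose d : dir n := (k, (c k < 0)%R).
have [|w ew] := IH (neighbor c d).
  rewrite -ltnS; apply: leq_trans le; rewrite (bigD1 k) //= [X in _ < X](bigD1 k) //=.
  have -> : \sum_(i < n | i != k) `|neighbor c d i|%N = \sum_(i < n | i != k) `|c i|%N.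
    by apply: eq_bigr => i ik; rewrite ffunE (negbTE ik) GRing.addr0.
  by rewrite ltn_add2r ffunE eqxx /=; move: ck; move: (c k) => ck; case: ifP; lia.
exists (rcons w (dir_port L (neighbor c d) (k, ~~ d.2))).
rewrite -cats1 follow_cat ew /= /leave dir_portK.
apply/ffunP => i; rewrite !ffunE /=; case: eqP => _; case: (c k < 0)%R => /=;
  by rewrite ?GRing.addr0 ?GRing.addrK ?GRing.addrNK.
Qed.
End Walker.


(** * Three synchronous agents *)

Section Sync.
Variables (n : nat) (hn : 0 < n) (S : finType) (md K : nat).
Variable op : S -> view n -> nat -> S * (nat * nat) * option (port n).
Local Notation port0 := (port0 hn).
Local Notation nxt := (nxt hn).
Local Notation prv := (prv hn).

Local Notation ctx := (ctx n S md).
Local Notation ctx_next := (ctx_next op).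
Local Notation ctx_num := (ctx_num op).
Local Notation ctx_den := (ctx_den op).
Local Notation ctx_move := (ctx_move op).

(* Agent 0 is [SBase], agent 1 the storage ([SIdle], [SFetch], [SChase]) and
   agent 2 the messenger.  A forward moving or resting agent remembers the port
   by which it entered its cell; the states [SFetch], [SHome] and [SReturn] of
   backward moving ones hold the port by which the tour leaves it, because the
   entry port can only be computed from the labels seen there. *)
Inductive sync_state :=
  | SBase
  | SIdle of port n
  | SFetch of ctx & 'I_K.+1 & port n
  | SChase of port n
  | SHome of ctx & port n
  | SWalk of ctx & port n
  | SReturn of ctx & port n
  | SRun of ctx & 'I_K.+1 & port n.

Definition sync_code (s : sync_state) :
    unit + (port n + (ctx * 'I_K.+1 * port n) + port n)
    + (ctx * port n + ctx * port n + (ctx * port n + ctx * 'I_K.+1 * port n)) :=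
  match s with
  | SBase => inl (inl tt)
  | SIdle q => inl (inr (inl (inl q)))
  | SFetch c t p => inl (inr (inl (inr (c, t, p))))
  | SChase q => inl (inr (inr q))
  | SHome c p => inr (inl (inl (c, p)))
  | SWalk c q => inr (inl (inr (c, q)))
  | SReturn c p => inr (inr (inl (c, p)))
  | SRun c t q => inr (inr (inr (c, t, q)))
  end.

Definition sync_decode s :=
  match s with
  | inl (inl tt) => SBase
  | inl (inr (inl (inl q))) => SIdle q
  | inl (inr (inl (inr (c, t, p)))) => SFetch c t p
  | inl (inr (inr q)) => SChase q
  | inr (inl (inl (c, p))) => SHome c p
  | inr (inl (inr (c, q))) => SWalk c q
  | inr (inr (inl (c, p))) => SReturn c p
  | inr (inr (inr (c, t, q))) => SRun c t q
  end.

Lemma sync_codeK : cancel sync_code sync_decode.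
Proof. by case. Qed.

HB.instance Definition _ := Finite.copy sync_state (can_type sync_codeK).

Definition go_forth (F : port n -> sync_state) (g : view n) (q : port n) :=
  (F (g (nxt g q)), Some (nxt g q)).
Definition go_back (F : port n -> sync_state) (g : view n) (p : port n) :=
  (F (g (prv g p)), Some (prv g p)).

(** The messenger goes home ([SHome]) and walks out counting ([SWalk]) to the storage. Then it
    returns ([SReturn]) and runs on ([SRun]), waiting [den] steps per cell, while the storage comes
    back waiting [num] steps per cell ([SFetch]) and chases ([SChase]). Partners compare entry
    ports, since a tour may revisit a cell. *)
Definition sync_delta : transition n sync_state := fun s V g =>
  let at_base p := (SBase \in V) && (p == nxt g port0) in
  match s with
  | SBase =>
      (SBase, if [pick c | SFetch c ord0 (nxt g port0) \in V] is Some c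
              then ctx_move c else None)
  | SIdle q =>
      if [pick c | SWalk c q \in V] is Some c then (SFetch c ord0 (nxt g q), None)
      else (s, None)
  | SFetch c t p =>
      if (t == ord0) && at_base p then (SChase port0, ctx_move c)
      else if t < ctx_num c then (SFetch c (inord t.+1) p, None)
      else go_back (SFetch c ord0) g p
  | SChase q =>
      if [exists c, SRun c ord0 q \in V] then (SIdle q, None) else go_forth SChase g q
  | SHome c p =>
      if at_base p then (SWalk (ctx_next c, g, inZp 0) port0, None)
      else go_back (SHome c) g p
  | SWalk c q =>
      if SIdle q \in V then (SReturn c (nxt g q), None)
      else go_forth (SWalk (c.1, inZp c.2.+1)) g q
  | SReturn c p =>
      if at_base p then (SRun c ord0 port0, ctx_move c) else go_back (SReturn c) g p
  | SRun c t q =>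
      if (t == ord0) && (SChase q \in V) then (SHome c (nxt g q), None)
      else if t < ctx_den c then (SRun c (inord t.+1) q, None)
      else go_forth (SRun c ord0) g q
  end.

Definition agent := (cell n * sync_state)%type.
Definition team := (agent * agent * agent)%type.

Definition sees (T : team) (c : cell n) : {set sync_state} :=
  [set s | [|| (T.1.1.1 == c) && (s == T.1.1.2), (T.1.2.1 == c) && (s == T.1.2.2)
             | (T.2.1 == c) && (s == T.2.2)]].

Variable L : labeling n.

Definition acts (T : team) (z : agent) : agent :=
  let r := sync_delta z.2 (sees T z.1) (obs_ports L z.1) in (hop L z.1 r.2, r.1).
Definition team_step (T : team) : team := (acts T T.1.1, acts T T.1.2, acts T T.2).

(** The three agents use disjoint sets of states, so a state seen in a cell identifies its agent. *)
Definition role (s : sync_state) : nat :=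
  match s with
  | SBase => 0
  | SIdle _ | SFetch _ _ _ | SChase _ => 1
  | _ => 2
  end.

Definition roles (T : team) :=
  [&& role T.1.1.2 == 0, role T.1.2.2 == 1 & role T.2.2 == 2].

Lemma sees0 T c : roles T -> (SBase \in sees T c) = (T.1.1.1 == c).
Proof.
case: T => [[[a sa] [b sb]] [d sd]] /and3P[/= ra /eqP rb /eqP rd].
rewrite inE /=; case: (SBase =P sb) => [e|_]; first by rewrite -e in rb.
case: (SBase =P sd) => [e|_]; first by rewrite -e in rd.
by case: sa ra => //= _; rewrite eqxx !andbF !orbF andbT.
Qed.

Lemma sees1 T s c : roles T -> role s = 1 ->
  (s \in sees T c) = (T.1.2.1 == c) && (s == T.1.2.2).
Proof.
case: T => [[[a sa] [b sb]] [d sd]] /and3P[/= /eqP ra /eqP rb /eqP rd] rs.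
rewrite inE /=; case: (s =P sa) => [e|_]; first by rewrite -e rs in ra.
case: (s =P sd) => [e|_]; first by rewrite -e rs in rd.
by rewrite !andbF orbF.
Qed.

Lemma sees2 T s c : roles T -> role s = 2 ->
  (s \in sees T c) = (T.2.1 == c) && (s == T.2.2).
Proof.
case: T => [[[a sa] [b sb]] [d sd]] /and3P[/= /eqP ra /eqP rb /eqP rd] rs.
rewrite inE /=; case: (s =P sa) => [e|_]; first by rewrite -e rs in ra.
case: (s =P sb) => [e|_]; first by rewrite -e rs in rb.
by rewrite !andbF.
Qed.

Hypothesis nc : no_port_cycle L.
Hypothesis op_ok : admissible md op K.

Local Notation obs := (obs_ports L).
Local Notation out := (out hn L).
Local Notation line := (line hn L).
Local Notation run3 := (reach team_step).

Definition base_agent x : agent := (x, SBase).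
Definition agent_in (F : port n -> sync_state) x i : agent :=
  ((line x i).1, F (line x i).2).
Definition agent_out (F : port n -> sync_state) x i : agent :=
  ((line x i).1, F (out (line x i))).

Lemma go_forth_line F x i :
  let r := go_forth F (obs (line x i).1) (line x i).2 in
  (hop L (line x i).1 r.2, r.1) = agent_in F x i.+1.
Proof. by rewrite /= obs_portsE. Qed.

Lemma go_back_line F x i :
  let r := go_back F (obs (line x i.+1).1) (out (line x i.+1)) in
  (hop L (line x i.+1).1 r.2, r.1) = agent_out F x i.
Proof. by rewrite /go_back prv_out [LHS]/= far_line leave_line. Qed.

Definition sync_at (z : cell n * nat * S) (T : team) := exists c,
  ctx_next c = z.2 /\
  T = (base_agent z.1.1, agent_in SIdle z.1.1 z.1.2, agent_out (SHome c) z.1.1 0).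

Lemma sync_home x d c i :
  run3 (base_agent x, agent_in SIdle x d, agent_out (SHome c) x i)
       (base_agent x, agent_in SIdle x d, agent_out (SHome c) x 0).
Proof.
elim: i => [|i IH]; first exact: reach_refl.
apply: reach_step; move: IH; congr (run3 _ _).
set T := (_, _, agent_out (SHome c) x i.+1); have rT : roles T by [].
rewrite /team_step /acts; congr (_, _, _).
- by rewrite /=; case: pickP => [c'|//]; rewrite sees1 //= => /andP[_ /eqP].
- by rewrite /=; case: pickP => [c'|//]; rewrite sees2 //= => /andP[_ /eqP].
- have := go_back_line (SHome c) x i; have := line_base hn nc x i.+1.
  rewrite {}/T /agent_out in rT *; move: (line x i.+1) rT => z rT lb <-.
  by rewrite /= sees0 //= lb.
Qed.

Lemma sync_meet x d c : exists2 T, sync_at (x, d, ctx_next c) T &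
  run3 (base_agent x, agent_in SChase x d, agent_in (SRun c ord0) x d) T.
Proof.
eexists; first by exists c.
apply: reach_step; apply: reach_trans (sync_home x d c d).
set T := (_, _, _); have rT : roles T by [].
rewrite (_ : team_step T = (base_agent x, agent_in SIdle x d, agent_out (SHome c) x d)).
  exact: reach_refl.
rewrite /team_step /acts /=; congr (_, _, _).
- by case: pickP => [c'|//]; rewrite sees1 //= => /andP[_ /eqP].
- case: existsP => // -[]; exists c; by rewrite sees2 //= !eqxx.
- by rewrite sees1 //= !eqxx.
Qed.

(** The runner starts with its waiting time used up, so it does not meet the chaser at index 0; both
    advance at once and meet at index 1. *)
Lemma sync_init x c : exists2 T, sync_at (x, 1, ctx_next c) T &
  run3 (base_agent x, agent_in SChase x 0, agent_in (SRun c (inord (ctx_den c))) x 0) T.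
Proof.
have [T HT run] := sync_meet x 1 c; exists T => //.
apply: reach_step; move: run; congr (run3 _ _).
have [d0 dK] := andP (den_bounds op_ok c).
set T0 := (base_agent x, _, agent_in _ _ 0); have rT : roles T0 by [].
have ti : (inord (ctx_den c) : 'I_K.+1) = ctx_den c :> nat by rewrite inordK.
have tn : (inord (ctx_den c) == ord0 :> 'I_K.+1) = false.
  by rewrite -val_eqE /= ti; case: (ctx_den c) d0.
rewrite /team_step /acts; congr (_, _, _).
- by rewrite /=; case: pickP => [c'|//]; rewrite sees1 //= => /andP[_ /eqP].
- rewrite /=; case: existsP => [[c']|_]; last by rewrite -go_forth_line.
  by rewrite sees2 //= => /andP[_ /eqP[_ e]]; rewrite -e eqxx in tn.
- by rewrite /= tn ti ltnn /= -go_forth_line.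
Qed.

Section Macro.
Variables (x : cell n) (k : nat) (s : S).
Hypothesis k_gt0 : 0 < k.

Let w i : ctx := (s, obs x, inZp i).

Let num := ctx_num (w k).
Let den := ctx_den (w k).
Let y := hop L x (ctx_move (w k)).

Lemma sync_walk_step i : i < k ->
  team_step (base_agent x, agent_in SIdle x k, agent_in (SWalk (w i)) x i)
  = (base_agent x, agent_in SIdle x k, agent_in (SWalk (w i.+1)) x i.+1).
Proof.
move=> lt; set T := (_, _, _); have rT : roles T by [].
rewrite /team_step /acts /=; congr (_, _, _).
- case: pickP => [c|//]; by rewrite sees1 //= => /andP[_ /eqP].
- case: pickP => [c|//]; rewrite sees2 //= => /andP[/eqP e1 /eqP[_ e3]].
  by have := line_eq nc e1 (esym e3) => e; rewrite e ltnn in lt.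
- rewrite sees1 //=; case: ifP => [/andP[/eqP e1 /eqP[e2]]|_].
    by have := line_eq nc e1 (esym e2) => e; rewrite e ltnn in lt.
  rewrite -(go_forth_line (SWalk (w i.+1))) /=.
  congr (_, SWalk (_, _) _); apply: val_inj => /=.
  by rewrite -addn1 modnDml addn1.
Qed.

Lemma sync_walk_stop :
  team_step (base_agent x, agent_in SIdle x k, agent_in (SWalk (w k)) x k)
  = (base_agent x, agent_out (SFetch (w k) ord0) x k, agent_out (SReturn (w k)) x k).
Proof.
set T := (_, _, _); have rT : roles T by [].
rewrite /team_step /acts /=; congr (_, _, _).
- case: pickP => [c|//]; by rewrite sees1 //= => /andP[_ /eqP].
- case: pickP => [c|/(_ (w k))]; rewrite sees2 //= ?eqxx // => /andP[_ /eqP[->]].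
  by [].
- by rewrite sees1 //= !eqxx.
Qed.

(* [t] is the time elapsed since storage and messenger left [line x k]; [u] is
   a waiting counter. *)
Definition fetching t (zA zB : agent) := exists i u,
  [/\ [/\ i <= k, u <= num, (i = 0 -> u = 0) & t = num.+1 * (k - i) + u],
      zA = base_agent x & zB = agent_out (SFetch (w k) (inord u)) x i].
Definition chasing t (zA zB : agent) := exists j,
  [/\ t = num.+1 * k + 1 + j, zA = base_agent y & zB = agent_in SChase y j].
Definition returning t (zC : agent) := exists i,
  [/\ i <= k, t = k - i & zC = agent_out (SReturn (w k)) x i].
Definition running t (zC : agent) := exists j u,
  [/\ u <= den, t = k + 1 + den.+1 * j + u & zC = agent_in (SRun (w k) (inord u)) y j].

Lemma fetch_step t (T : team) : roles T -> fetching t T.1.1 T.1.2 ->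
  let T' := team_step T in
  fetching t.+1 T'.1.1 T'.1.2 \/ chasing t.+1 T'.1.1 T'.1.2.
Proof.
case: T => [[zA zB] zC] rT [i [u [[ik un iu ->] /= eA eB]]].
move: rT; rewrite {zA}eA {zB}eB; set T := (_, _, _) => rT /=.
have [n0 nK] := andP (num_bounds op_ok (w k)); rewrite -/num in n0 nK.
have inu v : v <= num -> (inord v : 'I_K.+1) = v :> nat.
  by move=> le; rewrite inordK // ltnS (leq_trans le).
(* The base agent recognizes the state of a storage about to leave the base and moves to [y] in the
   same step. *)
have actA : acts T (base_agent x) = base_agent (if i == 0 then y else x).
  rewrite /acts /=; case: pickP => [c|/(_ (w k))]; rewrite sees1 //=.
    move=> /andP[/eqP e1 /eqP[ec _ eo]]; move: (line_base hn nc x i).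
    by rewrite e1 -eo !eqxx /= => <-; rewrite ec.
  case: (eqVneq i 0) => [i0|//]; have u0 := iu i0.
  by rewrite i0 u0 /= eqxx inord_0 eqxx.
have actB : acts T T.1.2 = if i == 0 then agent_in SChase y 0 else
    if u < num then agent_out (SFetch (w k) (inord u.+1)) x i
    else agent_out (SFetch (w k) (inord 0)) x i.-1.
  rewrite /acts /= sees0 //= (line_base hn nc).
  case: (eqVneq i 0) => [i0|i0].
    by rewrite (iu i0) i0 andbT inord_0 eqxx.
  rewrite andbF inu // -/num; case: ifP => // _.
  case: i i0 {ik iu rT actA T} => // i _; rewrite -go_back_line.
  by rewrite inord_0.
rewrite actA actB; case: (eqVneq i 0) => [i0|i0].
  by right; exists 0; split=> //; rewrite (iu i0) i0; lia.
left; case: ifP => [lt|/negbT]; last rewrite -leqNgt => ge.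
  by exists i, u.+1; split=> //; split=> //; [move/eqP: i0|lia].
exists i.-1, 0; split=> //; split=> //; first by lia.
have -> : u = num by lia.
have -> : k - i.-1 = (k - i).+1 by move: i0 ik; clear; lia.
by rewrite mulnS; lia.
Qed.

Let d := k * num %/ den.
(** The arrival time of the runner at distance [d]. The chaser gets there at [num.+1 * k + 1 + d],
    the same time because [den * d = k * num]. *)
Let t_end := k + 1 + den.+1 * d.

Lemma den_d : den * d = k * num.
Proof. by rewrite mulnC divnK // dvdn_mulr // (den_dvdn op_ok). Qed.

Lemma inord_tick u : u <= num \/ u <= den -> (inord u : 'I_K.+1) = u :> nat.
Proof.
have [_ nK] := andP (num_bounds op_ok (w k)).
have [_ dK] := andP (den_bounds op_ok (w k)).
by case=> le; rewrite inordK // ltnS (leq_trans le).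
Qed.

Lemma inord_tick0 u : u <= den -> ((inord u : 'I_K.+1) == ord0) = (u == 0).
Proof. by move=> le; rewrite -val_eqE /= inord_tick //; right. Qed.

(* [t] is a time at which the chaser is at distance [j] and the runner just
   arrived at distance [j']. *)
Lemma meeting_time t j j' :
  t = num.+1 * k + 1 + j -> t = k + 1 + den.+1 * j' -> j = j' -> t = t_end.
Proof.
move=> e1 e2 ej; rewrite e2 /t_end; congr (_ + _ * _).
have [d0 _] := andP (den_bounds op_ok (w k)).
have : den * j' = den * d by rewrite den_d; move: e1; rewrite e2 ej !mulSn mulnC; lia.
by move/eqP; rewrite eqn_pmul2l // => /eqP.
Qed.

(** A chaser that stops sees a runner with tick 0 and its own entry port; then their indices agree
    by [line_eq], and [meeting_time] excludes this before [t_end]. *)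
Lemma chase_step t (T : team) : roles T -> t < t_end ->
  chasing t T.1.1 T.1.2 -> running t T.2 ->
  let T' := team_step T in chasing t.+1 T'.1.1 T'.1.2.
Proof.
case: T => [[zA zB] zC] rT lt [j [et /= eA eB]] [j' [u [ud et' /= eC]]].
move: rT; rewrite {zA}eA {zB}eB {zC}eC; set T := (_, _, _) => rT.
exists j.+1; split; first by rewrite et; lia.
- rewrite /acts /=; case: pickP => [c|//].
  by rewrite sees1 //= => /andP[_ /eqP].
- rewrite /acts /=; case: existsP => [[c]|_]; last by rewrite -go_forth_line.
  rewrite sees2 //= => /andP[/eqP e1 /eqP[_ eu e2]].
  have /(line_eq nc) e3 := e1; have u0 : u = 0.
    by apply/eqP; rewrite -inord_tick0 // -eu.
  rewrite (@meeting_time t j j') ?ltnn // in lt; first by rewrite et' u0 addn0.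
  by apply/esym/e3/esym.
Qed.

Lemma return_step t (T : team) : roles T -> T.1.1 = base_agent x -> returning t T.2 ->
  let T' := team_step T in returning t.+1 T'.2 \/ running t.+1 T'.2.
Proof.
case: T => [[zA zB] zC] rT /= eA [i [ik et /= eC]].
move: rT; rewrite {zA}eA {zC}eC; set T := (_, _, _) => rT.
rewrite /acts /= sees0 //= (line_base hn nc); case: (eqVneq i 0) => [i0|i0].
  right; exists 0, 0; split=> //; first by rewrite et i0; lia.
  by rewrite i0 inord_0.
left; exists i.-1; case: i i0 ik et {rT T} => // i _ ik et; split; [lia|lia|].
by rewrite -go_back_line.
Qed.

Lemma run_step t (T : team) : roles T -> t < t_end ->
  fetching t T.1.1 T.1.2 \/ chasing t T.1.1 T.1.2 -> running t T.2 ->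
  let T' := team_step T in running t.+1 T'.2.
Proof.
case: T => [[zA zB] zC] rT lt /= HB [j [u [ud et /= eC]]].
move: rT; rewrite {zC}eC; set T := (_, _, _) => rT.
rewrite /acts /= inord_tick0 // sees1 //=.
case: ifP => [/and3P[/eqP u0 /eqP e1 /eqP e2]|_].
  case: HB => [[i [v [_ _ eB]]]|[j' [et' _ eB]]]; first by rewrite eB in e2.
  rewrite eB /= in e1 e2; case: e2 => e2.
  have := line_eq nc e1 (esym e2) => e.
  rewrite (@meeting_time t j' j) ?ltnn // in lt.
  by rewrite et u0 addn0.
rewrite inord_tick -/den; last by right.
case: ifP => [lt'|/negbT]; last rewrite -leqNgt => ge.
  by exists j, u.+1; split=> //; lia.
exists j.+1, 0; split=> //; first by rewrite et mulnS; lia.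
by rewrite -go_forth_line inord_0.
Qed.

Definition transporting t (T : team) := roles T /\
  (fetching t T.1.1 T.1.2 \/ chasing t T.1.1 T.1.2) /\
  (returning t T.2 \/ running t T.2).

Lemma transport_step t T : t < t_end -> transporting t T ->
  transporting t.+1 (team_step T).
Proof.
move=> lt [rT [HB HC]].
have HB' : fetching t.+1 (team_step T).1.1 (team_step T).1.2 \/
           chasing t.+1 (team_step T).1.1 (team_step T).1.2.
  case: HB => [/(fetch_step rT) //|HB]; right.
  (* A chase begins only after time [k], when the messenger can no longer be returning. *)
  apply: chase_step => //; case: HC => // -[i [_ e _]].
  by case: HB => j [e' _ _]; move: e'; rewrite e mulSn; lia.
have HC' : returning t.+1 (team_step T).2 \/ running t.+1 (team_step T).2.
  case: HC => [HC|HC]; last by right; apply: run_step.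
  (* Conversely, while the messenger returns the storage is still fetching, so the base agent is
     still at [x]. *)
  apply: (return_step rT) => //; case: HB => [[i [u [_ -> _]]] //|[j [e _ _]]].
  by case: HC => i [_ e' _]; move: e; rewrite e' mulSn; lia.
split=> //; apply/and3P; split; apply/eqP.
- by case: HB' => [[i [u [_ -> _]]]|[j [_ -> _]]].
- by case: HB' => [[i [u [_ _ ->]]]|[j [_ _ ->]]].
- by case: HC' => [[i [_ _ ->]]|[j [u [_ _ ->]]]].
Qed.

Lemma transport_end T : transporting t_end T ->
  T = (base_agent y, agent_in SChase y d, agent_in (SRun (w k) ord0) y d).
Proof.
case: T => [[zA zB] zC] [_ /= [HB HC]].
have e0 : t_end = num.+1 * k + 1 + d.
  by rewrite /t_end [den.+1 * d]mulSn den_d mulSn mulnC; lia.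
have [j ej [-> ->]] : exists2 j, t_end = num.+1 * k + 1 + j &
    zA = base_agent y /\ zB = agent_in SChase y j.
  case: HB => [[i [u [[ik un iu e] _ _]]]|[j [e -> ->]]]; last by exists j.
  case: i ik iu e => [|i] ik iu e; first by move: e; rewrite iu // subn0; lia.
  have : num.+1 * (k - i.+1).+1 <= num.+1 * k by rewrite leq_mul2l; lia.
  by rewrite mulnS; lia.
have -> : j = d by lia.
have [j' [u [ud e ->]]] : running t_end zC.
  by case: HC => // -[i [_ e _]]; move: e; rewrite e0 mulSn; lia.
have e1 : den.+1 * d = den.+1 * j' + u by rewrite /t_end in e; lia.
(* Both sides of [e1] are divided by [den.+1]; the remainder [u] is at most [den]. *)
have e2 : d = j'.
  have := congr1 (divn^~ den.+1) e1; rewrite mulKn // mulnC divnMDl //.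
  by rewrite divn_small // addn0.
have u0 : u = 0 by lia.
by rewrite e2 u0 inord_0.
Qed.

Lemma sync_transport T : transporting 0 T ->
  run3 T (base_agent y, agent_in SChase y d, agent_in (SRun (w k) ord0) y d).
Proof.
move=> HT; exists t_end; apply: transport_end.
suff H t : t <= t_end -> transporting t (iter t team_step T) by exact: H.
by elim: t => // t IH lt; exact: transport_step lt (IH (ltnW lt)).
Qed.

Lemma sync_walk i : i <= k ->
  run3 (base_agent x, agent_in SIdle x k, agent_in (SWalk (w 0)) x 0)
       (base_agent x, agent_in SIdle x k, agent_in (SWalk (w i)) x i).
Proof.
elim: i => [|i IH] le; first exact: reach_refl.
apply: reach_trans (IH (ltnW le)) _; apply: reach_step.
by rewrite sync_walk_step //; exact: reach_refl.
Qed.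

Lemma sync_macro T : sync_at (x, k, s) T ->
  exists2 T', sync_at (mstep md op L (x, k, s)) T' & run3 T T'.
Proof.
case=> c [ec ->].
rewrite -[mstep _ _ _ _]/(y, d, ctx_next (w k)).
have [T' HT' run] := sync_meet y d (w k); exists T' => //.
apply: reach_step; apply: reach_trans run.
set T0 := (_, _, _); have rT : roles T0 by [].
rewrite (_ : team_step T0 =
    (base_agent x, agent_in SIdle x k, agent_in (SWalk (w 0)) x 0)).
  apply: reach_trans (sync_walk (leqnn k)) _.
  apply: reach_step; rewrite sync_walk_stop; apply: sync_transport.
  split=> //; split; left; exists k.
    exists 0; split=> //; first by split=> //; lia.
    by rewrite inord_0.
  by split=> //; lia.
rewrite /team_step /acts /=; congr (_, _, _).
- by case: pickP => [c'|//]; rewrite sees1 //= => /andP[_ /eqP].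
- by case: pickP => [c'|//]; rewrite sees2 //= => /andP[_ /eqP].
- by rewrite sees0 //= eqxx -[nxt _ _]/(out (line x 0)) eqxx /= ec.
Qed.

End Macro.

Lemma sync_simulation z T : 0 < z.1.2 -> sync_at z T ->
  exists2 T', sync_at (mstep md op L z) T' & run3 T T'.
Proof. by case: z => [[x k] s] k_gt0 zT; exact: (sync_macro k_gt0 zT). Qed.

Definition team_of (cf : config n 3 sync_state) : team :=
  let z i := (cpos cf i, cst cf i) in (z ord0, z (inord 1), z ord_max).

Lemma team_of_step cf : team_of (step L (@sync_delta) setT cf) = team_step (team_of cf).
Proof.
have V i : obs_states cf i = sees (team_of cf) (cpos cf i).
  apply/setP => s; rewrite inE /=; apply/imsetP/idP.
    case=> j; rewrite inE => /eqP <- ->.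
    have : (j == ord0) || (j == inord 1) || (j == ord_max).
      by case: j => -[|[|[|]]] // lt; rewrite -!val_eqE /= ?inordK.
    by case/orP => [/orP[]|] /eqP ->; rewrite !eqxx ?orbT.
  case/or3P => /andP[/eqP <- /eqP ->]; eexists; rewrite ?inE ?eqxx //.
rewrite /team_of /step /team_step /acts /= !in_setT !V /=.
by congr (_, _, _).
Qed.

End Sync.

(** * A head and three pebbles under semi-synchronous scheduling *)

(* A command consists of the set of pebbles to be carried along, the mark that
   they receive, the port to leave through ([None] to stay) and the next head
   state.  The head announces a move and leaves only after all pebbles that it
   carries have left its cell, so the schedule does not affect the outcome. *)
Section Pebbles.
Variables (n : nat) (head : finType).

Definition pebble := option bool.
Definition command := ({set pebble} * port n * option (port n) * head)%type.
Variable prog : head -> view n -> {set pebble * port n} -> command.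

Definition carry := ({set pebble} * port n * port n * head)%type.
Definition peb_state : finType := (head + carry + pebble * port n)%type.

Definition peb_delta : transition n peb_state := fun s V g =>
  match s with
  | inl (inl h) =>
      let: (m, q, mv, h') := prog h g [set z | inr z \in V] in
      (inl (if mv is Some p then inr (m, q, p, h') else inl h'), None)
  | inl (inr (m, q, p, h)) =>
      if [exists z, (z.1 \in m) && (inr z \in V)] then (s, None)
      else (inl (inl h), Some p)
  | inr (i, d) =>
      if [pick a : carry | (i \in a.1.1.1) && (inl (inr a) \in V)] is Some a
      then (inr (i, a.1.1.2), Some a.1.2) else (s, None)
  end.

Variable L : labeling n.

Definition placing := {ffun pebble -> cell n * port n}.
Definition pconf := (cell n * head * placing)%type.

Definition visible (c : cell n) (pp : placing) : {set pebble * port n} :=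
  [set z | pp z.1 == (c, z.2)].
Definition carried (c : cell n) (m : {set pebble}) p q (pp : placing) : placing :=
  [ffun i => if (i \in m) && ((pp i).1 == c) then (leave L c p, q) else pp i].

Definition pstep (z : pconf) : pconf :=
  let: (c, h, pp) := z in
  let: (m, q, mv, h') := prog h (obs_ports L c) (visible c pp) in
  if mv is Some p then (leave L c p, h', carried c m p q pp) else (c, h', pp).

Definition peb_agent (i : pebble) : 'I_4 :=
  match i with None => inord 1 | Some true => inord 2 | Some false => inord 3 end.

Lemma peb_agent_cover (j : 'I_4) : j = ord0 \/ exists i, j = peb_agent i.
Proof.
case: j => -[|[|[|[|]]]] // lt; [left|right; exists None|right; exists (Some true)
  |right; exists (Some false)]; by apply: val_inj; rewrite /= ?inordK.
Qed.

Local Notation conf := (config n 4 peb_state).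

Definition holds (cf : conf) c (s : head + carry) (pp : placing) :=
  [/\ cpos cf ord0 = c, cst cf ord0 = inl s &
      forall i, cpos cf (peb_agent i) = (pp i).1 /\
                cst cf (peb_agent i) = inr (i, (pp i).2)].

Lemma holds_pebble cf c s pp j z : holds cf c s pp ->
  (inr z \in obs_states cf j) = (pp z.1 == (cpos cf j, z.2)).
Proof.
case=> ec es ep; apply/imsetP/eqP => [[j']|e].
  rewrite inE => /eqP <-; case: (peb_agent_cover j') => [->|[i ->]].
    by rewrite es.
  by have [-> ->] := ep i => -[->]; case: (pp i).
have [e1 e2] := ep z.1; exists (peb_agent z.1); rewrite ?inE ?e1 ?e2 e //=.
by rewrite -surjective_pairing.
Qed.

Lemma holds_head cf c s pp j a : holds cf c s pp ->
  (inl a \in obs_states cf j) = (c == cpos cf j) && (a == s).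
Proof.
case=> ec es ep; apply/imsetP/andP => [[j']|[/eqP e /eqP ->]].
  rewrite inE => /eqP <-; case: (peb_agent_cover j') => [->|[i ->]].
    by rewrite es ec => -[->].
  by have [_ ->] := ep i.
by exists ord0; rewrite ?inE ?es // ec e.
Qed.

Variable sched : nat -> {set 'I_4}.
Hypothesis fair_sched : fair sched.
Variable init : 'I_4 -> peb_state.
Local Notation run := (run L peb_delta init sched).
Local Notation step := (step L peb_delta).

(** A leads-to rule: [P] persists until [Q] holds, and an activation of agent [i], which fairness
    guarantees, forces [Q]. *)
Lemma fair_leads (P Q : conf -> Prop) i t :
  (forall cf (A : {set 'I_4}), P cf -> P (step A cf) \/ Q (step A cf)) ->
  (forall cf (A : {set 'I_4}), i \in A -> P cf -> Q (step A cf)) ->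
  P (run t) -> exists t', Q (run t').
Proof.
move=> stay go; have [t' le it] := fair_sched i t.
have [u] : exists u, t' = t + u by exists (t' - t); rewrite subnKC.
elim: u t {le} => [|u IH] t et Pt.
  by exists t'.+1; apply: go it _; rewrite et addn0.
case: (stay _ (sched t) Pt) => [Pt'|Qt']; last by exists t.+1.
by apply: (IH t.+1) => //; rewrite et addnS.
Qed.

Lemma step_plain (cf : conf) c h pp (A : {set 'I_4}) : holds cf c (inl h) pp ->
  let: (m, q, mv, h') := prog h (obs_ports L c) (visible c pp) in
  let s := if mv is Some p then inr (m, q, p, h') else inl h' in
  holds (step A cf) c (if ord0 \in A then s else inl h) pp.
Proof.
case eprog: (prog _ _ _) => [[[m q] mv] h'] H; have [ec es ep] := H.
split; last first.
- move=> i; have [epc eps] := ep i; rewrite /=; case: ifP => _ //.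
  rewrite eps /=; case: pickP => // a; rewrite (holds_head _ _ H).
  by rewrite !andbF.
- rewrite /= es; case: ifP => //= _; rewrite ec.
  rewrite (_ : [set z | _] = visible c pp) ?eprog //.
  by apply/setP => z; rewrite !inE (holds_pebble _ _ H) ec.
- rewrite /= es; case: ifP => //= _; case: (prog _ _ _) => [[[? ?] ?] ?] /=.
  by rewrite ec.
Qed.

Section Carry.
Variables (c : cell n) (m : {set pebble}) (p q : port n) (h : head) (pp : placing).

(** The placement once the pebbles of [D] have been active since the head announced its move. *)
Let mid (D : {set pebble}) : placing :=
  [ffun i => if i \in D then carried c m p q pp i else pp i].

(** A pebble that has followed the announcement is out of the head's cell, so further activations do
    not move it again. *)
Lemma carried_neq i : i \in m -> (carried c m p q pp i).1 != c.
Proof.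
by move=> im; rewrite ffunE im /=; case: ifP => [_|/negbT//]; exact: leave_neq.
Qed.

(** The negated clause gives progress: once all pebbles have been active, an activation of the head
    makes it leave. *)
Lemma step_carry D cf (A : {set 'I_4}) : holds cf c (inr (m, q, p, h)) (mid D) ->
  (holds (step A cf) c (inr (m, q, p, h)) (mid (D :|: [set i | peb_agent i \in A])) /\
    ~~ ((D == setT) && (ord0 \in A))) \/
  holds (step A cf) (leave L c p) (inl h) (carried c m p q pp).
Proof.
move=> H; have [ec es ep] := H; set D' := _ :|: _.
have pebs i : cpos (step A cf) (peb_agent i) = (mid D' i).1 /\
              cst (step A cf) (peb_agent i) = inr (i, (mid D' i).2).
  have [epc eps] := ep i.
  have -> : mid D' i = if (peb_agent i \in A) && (i \in m) && ((mid D i).1 == c)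
                       then (leave L c p, q) else mid D i.
    rewrite [LHS]ffunE !inE; have [iD|iD] := boolP (i \in D).
      rewrite [mid D i]ffunE iD /=; case: ifP => // /andP[/andP[_ im]].
      by rewrite (negbTE (carried_neq im)).
    rewrite [mid D i]ffunE (negbTE iD) /=; case: ifP => //= _.
    by rewrite ffunE; case: ifP.
  rewrite /=; case: ifP => //= _; rewrite eps /=.
  case: pickP => [a|/(_ (m, q, p, h))]; rewrite (holds_head _ _ H) epc /=.
    case/and3P=> ia /eqP <- /eqP[ea]; rewrite ea in ia *.
    by rewrite eqxx ia.
  by rewrite eqxx andbT eq_sym => ->.
case: (boolP (ord0 \in A)) => [A0|A0]; last first.
  by left; rewrite andbF; split=> //; split; rewrite //= (negbTE A0).
case: (boolP [exists z, (z.1 \in m) && (inr z \in obs_states cf ord0)]) => [ex|nex].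
  left; split; first by split; rewrite //= A0 es /= ex.
  rewrite andbT; apply/negP => /eqP DT; case/existsP: ex => z /andP[zm].
  rewrite (holds_pebble _ _ H) ec ffunE DT inE => /eqP e.
  by have := carried_neq zm; rewrite e eqxx.
right; split; [by rewrite /= A0 es /= (negbTE nex) /= ec
              | by rewrite /= A0 es /= (negbTE nex) | move=> i].
have [-> ->] := pebs i; suff -> : mid D' i = carried c m p q pp i by [].
rewrite ffunE; case: ifP => // /negbT; rewrite inE negb_or => /andP[iD _].
rewrite ffunE; case: ifP => // /andP[im /eqP e].
have /existsPn/(_ (i, (pp i).2)) := nex; rewrite im (holds_pebble _ _ H) ec.
by rewrite ffunE (negbTE iD) /= -{1}e -surjective_pairing eqxx.
Qed.

(** Fairness is used for each of the three pebbles in turn and then for the head, which may also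
    leave earlier if nothing remains to be carried. *)
Lemma carry_done t : holds (run t) c (inr (m, q, p, h)) pp ->
  exists t', holds (run t') (leave L c p) (inl h) (carried c m p q pp).
Proof.
move=> H0; pose done cf := holds cf (leave L c p) (inl h) (carried c m p q pp).
pose Q (M : {set pebble}) cf :=
  exists2 D : {set pebble}, M \subset D & holds cf c (inr (m, q, p, h)) (mid D).
pose P M cf := Q M cf \/ done cf.
have adv (M : {set pebble}) i t1 : Q M (run t1) -> exists t2, P (i |: M) (run t2).
  apply: (@fair_leads _ _ (peb_agent i)) => cf A; last first.
    move=> iA [D MD /(step_carry A)[[HD _]|]]; last by right.
    left; exists (D :|: [set i | peb_agent i \in A]) => //.
    by rewrite subUset sub1set !inE iA orbT /= (subset_trans MD) ?subsetUl.
  move=> [D MD /(step_carry A)[[HD _]|]]; last by right; right.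
  left; exists (D :|: [set i | peb_agent i \in A]) => //.
  by rewrite (subset_trans MD) ?subsetUl.
have fin t1 : Q setT (run t1) -> exists t2, done (run t2).
  apply: (@fair_leads _ _ ord0) => cf A; last first.
    move=> A0 [D]; rewrite subTset => /eqP-> /(step_carry A)[[_]|//].
    by rewrite eqxx A0.
  move=> [D MD /(step_carry A)[[HD _]|]]; last by right.
  left; exists (D :|: [set i | peb_agent i \in A]) => //.
  by rewrite (subset_trans MD) ?subsetUl.
have {H0} [t0 H0] : exists t0, P set0 (run t0).
  exists t; left; exists set0 => //; rewrite (_ : mid set0 = pp) //.
  by apply/ffunP => i; rewrite ffunE inE.
have adv' (M : {set pebble}) i t1 : P M (run t1) -> exists t2, P (i |: M) (run t2).
  by case=> [/adv -/(_ i)|d1]; last by exists t1; right.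
have [t1 H1] := adv' _ None _ H0; have [t2 H2] := adv' _ (Some true) _ H1.
have [t3 [H3|d3]] := adv' _ (Some false) _ H2; last by exists t3.
apply: (fin t3); move: H3; congr (Q _ _).
by apply/setP => i; rewrite !inE; case: i => [[]|].
Qed.
End Carry.

Lemma peb_sim t (z : pconf) : holds (run t) z.1.1 (inl z.1.2) z.2 ->
  exists t', holds (run t') (pstep z).1.1 (inl (pstep z).1.2) (pstep z).2.
Proof.
case: z => [[c h] pp] /=; case eprog: (prog _ _ _) => [[[m q] mv] h'] H0.
pose s : head + carry := if mv is Some p then inr (m, q, p, h') else inl h'.
have [t1 H1] : exists t1, holds (run t1) c s pp.
  apply: (@fair_leads (fun cf => holds cf c (inl h) pp)
                      (fun cf => holds cf c s pp) ord0 t _ _ H0) => cf A.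
    move=> H; have := step_plain A H; rewrite eprog /=.
    by case: ifP => _; [right | left].
  by move=> A0 H; have := step_plain A H; rewrite eprog /= A0.
by case: mv eprog @s H1 => [p|] eprog s H1; [exact: carry_done H1 | exists t1].
Qed.

Lemma peb_reach z z' t : holds (run t) z.1.1 (inl z.1.2) z.2 -> reach pstep z z' ->
  exists t', holds (run t') z'.1.1 (inl z'.1.2) z'.2.
Proof.
move=> H [u <-]; elim: u => [|u [t' /peb_sim]] //=; by exists t.
Qed.
End Pebbles.

(** * Four semi-synchronous agents *)

Section Head.
Variables (n : nat) (hn : 0 < n) (S : finType) (md K : nat).
Variable op : S -> view n -> nat -> S * (nat * nat) * option (port n).
Local Notation port0 := (port0 hn).
Local Notation nxt := (nxt hn).
Local Notation prv := (prv hn).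
Local Notation ctx := (ctx n S md).
Local Notation ctx_next := (ctx_next op).
Local Notation ctx_num := (ctx_num op).
Local Notation ctx_den := (ctx_den op).
Local Notation ctx_move := (ctx_move op).
Local Notation tick := 'I_K.+1.

(* Pebble [None] marks the base; the flag [b] says that [Some b] is the current
   storage and [Some (~~ b)] the next one.  The second flag of [HPull] and
   [HRet] is true during the first round, when [Some (~~ b)] still has to be
   taken from the old base to the new one.  A storage pebble is marked with its
   entry port until it is first pulled, and with the port of departure after. *)
Inductive carrier :=
  | HInit of ctx
  | HStart of ctx & port n
  | HHome of bool & ctx & port n
  | HWalk of bool & ctx & port n
  | HPull of bool & bool & ctx & tick & port n
  | HRet of bool & bool & ctx & port n
  | HSeek of bool & ctx & port n
  | HPush of bool & ctx & tick & port n
  | HBack of bool & ctx & port n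
  | HCheck of bool & ctx
  | HFind of bool & ctx & port n
  | HDone of bool & ctx.

Definition carrier_data :=
  ('I_12 * (bool * bool) * ctx * option tick * option (port n))%type.
Definition carrier_code (h : carrier) : carrier_data :=
  match h with
  | HInit c => (inord 0, (true, true), c, None, None)
  | HStart c q => (inord 1, (true, true), c, None, Some q)
  | HHome b c p => (inord 2, (b, true), c, None, Some p)
  | HWalk b c p => (inord 3, (b, true), c, None, Some p)
  | HPull b f c j p => (inord 4, (b, f), c, Some j, Some p)
  | HRet b f c p => (inord 5, (b, f), c, None, Some p)
  | HSeek b c p => (inord 6, (b, true), c, None, Some p)
  | HPush b c j p => (inord 7, (b, true), c, Some j, Some p)
  | HBack b c p => (inord 8, (b, true), c, None, Some p)
  | HCheck b c => (inord 9, (b, true), c, None, None)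
  | HFind b c p => (inord 10, (b, true), c, None, Some p)
  | HDone b c => (inord 11, (b, true), c, None, None)
  end.

Definition carrier_decode (x : carrier_data) : option carrier :=
  let: (i, (b, f), c, oj, oq) := x in
  match nat_of_ord i, oj, oq with
  | 0, None, None => Some (HInit c)
  | 1, None, Some q => Some (HStart c q)
  | 2, None, Some p => Some (HHome b c p)
  | 3, None, Some p => Some (HWalk b c p)
  | 4, Some j, Some p => Some (HPull b f c j p)
  | 5, None, Some p => Some (HRet b f c p)
  | 6, None, Some p => Some (HSeek b c p)
  | 7, Some j, Some p => Some (HPush b c j p)
  | 8, None, Some p => Some (HBack b c p)
  | 9, None, None => Some (HCheck b c)
  | 10, None, Some p => Some (HFind b c p)
  | 11, None, None => Some (HDone b c)
  | _, _, _ => None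
  end.

Lemma carrier_codeK : pcancel carrier_code carrier_decode.
Proof. by case=> *; rewrite /= inordK. Qed.

HB.instance Definition _ := Finite.copy carrier (pcan_type carrier_codeK).

Local Notation command := (command n carrier).

Definition stay (h : carrier) : command := (set0, port0, None, h).
Definition walk_on (F : port n -> carrier) (g : view n) q : command :=
  (set0, port0, Some (nxt g q), F (g (nxt g q))).
Definition walk_back (F : port n -> carrier) (g : view n) p : command :=
  (set0, port0, Some (prv g p), F (g (prv g p))).

(** A round pulls [Some b] by [den] cells ([HPull]), takes the base mark to the new base ([HRet]),
    pushes [Some (~~ b)] by [num] cells ([HPush]) and brings the base mark back ([HBack]), by the
    far label kept in the view [c.1.2]. [HCheck] ends the rounds when [Some b] has reached the
    base. *)
Definition carrier_prog (h : carrier) (g : view n) (V : {set pebble * port n})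
    : command :=
  let at_base p := ((None, port0) \in V) && (p == nxt g port0) in
  match h with
  | HInit c =>
      let p := nxt g port0 in ([set Some true], g p, Some p, HStart c (g p))
  | HStart c q => stay (HHome true c (nxt g q))
  | HHome b c p =>
      if at_base p then stay (HWalk b (ctx_next c, g, inZp 0) port0)
      else walk_back (HHome b c) g p
  | HWalk b c q =>
      if (Some b, q) \in V then stay (HPull b true c (inord (ctx_den c)) (nxt g q))
      else walk_on (HWalk b (c.1, inZp c.2.+1)) g q
  | HPull b f c j p =>
      if j == ord0 then stay (HRet b f c p)
      else let q := prv g p in
        ([set Some b], g q, Some q, HPull b f c (inord j.-1) (g q))
  | HRet b f c p =>
      if at_base p then
        ((if f then [set None; Some (~~ b)] else [set None]), port0, ctx_move c,
         if f then HPush b c (inord (ctx_num c)) port0 else HSeek b c port0)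
      else walk_back (HRet b f c) g p
  | HSeek b c q =>
      if (Some (~~ b), q) \in V then stay (HPush b c (inord (ctx_num c)) q)
      else walk_on (HSeek b c) g q
  | HPush b c j q =>
      if j == ord0 then stay (HBack b c (nxt g q))
      else let p := nxt g q in
        ([set Some (~~ b)], g p, Some p, HPush b c (inord j.-1) (g p))
  | HBack b c p =>
      if at_base p then ([set None], port0, omap c.1.2 (ctx_move c), HCheck b c)
      else walk_back (HBack b c) g p
  | HCheck b c =>
      if (Some b, nxt g port0) \in V then
        ([set None; Some b], port0, ctx_move c, HDone b c)
      else stay (HFind b c port0)
  | HFind b c q =>
      if (Some b, nxt g q) \in V then
        stay (HPull b false c (inord (ctx_den c)) (nxt g q))
      else walk_on (HFind b c) g q
  | HDone b c => stay (HHome (~~ b) c (nxt g port0))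
  end.

Variable L : labeling n.
Local Notation obs := (obs_ports L).
Local Notation out := (out hn L).
Local Notation line := (line hn L).
Local Notation hrun := (reach (pstep carrier_prog L)).

Definition place b (zA zB zD : cell n * port n) : placing n :=
  [ffun i => if i is Some b' then if b' == b then zB else zD else zA].

Lemma place_swap b zA zB zD : place (~~ b) zA zB zD = place b zA zD zB.
Proof. by apply/ffunP => -[b'|]; rewrite !ffunE //; case: b' b => [] []. Qed.

Lemma visible_place b zA zB zD c z : (z \in visible c (place b zA zB zD)) =
  ((if z.1 is Some b' then if b' == b then zB else zD else zA) == (c, z.2)).
Proof. by rewrite inE ffunE. Qed.

Lemma carried_place b c (m : {set pebble}) p q zA zB zD :
  let mv (i : pebble) (z : cell n * port n) :=
    if (i \in m) && (z.1 == c) then (leave L c p, q) else z in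
  carried L c m p q (place b zA zB zD) =
  place b (mv None zA) (mv (Some b) zB) (mv (Some (~~ b)) zD).
Proof.
by apply/ffunP => -[b'|]; rewrite !ffunE //; case: b' b => [] [].
Qed.

Lemma carried_none c p q pp : carried L c set0 p q pp = pp.
Proof. by apply/ffunP => i; rewrite ffunE inE. Qed.

Hypothesis nc : no_port_cycle L.
Hypothesis op_ok : admissible md op K.

Definition head_in (F : port n -> carrier) x i (pp : placing n) : pconf n carrier :=
  ((line x i).1, F (line x i).2, pp).
Definition head_out (F : port n -> carrier) x i (pp : placing n) : pconf n carrier :=
  ((line x i).1, F (out (line x i)), pp).

Lemma hrun_home F x i b zB zD :
  (forall g (V : {set pebble * port n}) p,
     ~~ (((None, port0) \in V) && (p == nxt g port0)) ->
     carrier_prog (F p) g V = walk_back F g p) ->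
  hrun (head_out F x i (place b (x, port0) zB zD))
       (head_out F x 0 (place b (x, port0) zB zD)).
Proof.
move=> HF; elim: i => [|i IH]; first exact: reach_refl.
apply: reach_step; move: IH; congr (hrun _ _).
rewrite {2}/head_out /pstep HF; last first.
  rewrite visible_place; have := line_base hn nc x i.+1.
  by move: (line x i.+1) => z /= h; rewrite xpair_eqE eqxx andbT h.
by rewrite /walk_back prv_out leave_line far_line carried_none.
Qed.

Lemma hrun_forth (F : nat -> port n -> carrier) x m pp :
  (forall i, i < m ->
     carrier_prog (F i (line x i).2) (obs (line x i).1) (visible (line x i).1 pp) =
     walk_on (F i.+1) (obs (line x i).1) (line x i).2) ->
  hrun (head_in (F 0) x 0 pp) (head_in (F m) x m pp).
Proof.
elim: m => [|m IH] HF; first exact: reach_refl.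
apply: reach_trans (IH _) _ => [i lt|]; first exact/HF/ltnW.
exists 1; rewrite /= /head_in /pstep HF // /walk_on carried_none.
by rewrite obs_portsE.
Qed.

Lemma line_pair_eq x i j :
  (line x i == ((line x j).1, (line x j).2)) = (i == j).
Proof. by rewrite -surjective_pairing (inj_eq (line_inj nc (x := x))). Qed.

Lemma tickK j : j <= K -> (inord j : tick) = j :> nat.
Proof. by move=> le; rewrite inordK. Qed.

Lemma hrun_pull b f c x a j zA zB zD : 0 < j <= K ->
  zB.1 = (line x (a + j)).1 ->
  hrun (head_out (HPull b f c (inord j)) x (a + j) (place b zA zB zD))
       (head_out (HPull b f c ord0) x a
          (place b zA ((line x a).1, out (line x a)) zD)).
Proof.
elim: j zB => // j IH zB; rewrite addnS => le eB; apply: reach_step.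
have tk : (inord j.+1 == ord0 :> tick) = false by rewrite -val_eqE /= tickK.
move: (leave_line hn L x (a + j)) (far_line hn L x (a + j)) (prv_out hn L x (a + j).+1).
rewrite /head_out; move: (line x (a + j).+1) eB => z eB e1 e2 e3.
rewrite {1}/pstep /= tk tickK //= e3 e1 e2 carried_place !inE /= eB !eqxx e1 /=.
have -> : (Some (~~ b) == Some b :> pebble) = false by case: b {IH}.
case: (posnP j) => [->|j0].
  by rewrite inord_0 addn0; exact: reach_refl.
by apply: IH => //; lia.
Qed.

Lemma hrun_push b c x a j zA zB zD : 0 < j <= K ->
  zD.1 = (line x a).1 ->
  hrun (head_in (HPush b c (inord j)) x a (place b zA zB zD))
       (head_in (HPush b c ord0) x (a + j) (place b zA zB (line x (a + j)))).
Proof.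
elim: j a zD => // j IH a zD le eD; apply: reach_step.
have tk : (inord j.+1 == ord0 :> tick) = false by rewrite -val_eqE /= tickK.
rewrite {1}/head_in /pstep /= tk tickK //= obs_portsE.
rewrite carried_place !inE /= eD eqxx /= eqxx.
have -> : (Some b == Some (~~ b) :> pebble) = false by case: b {IH}.
rewrite -addSnnS; case: (posnP j) => [->|j0].
  by rewrite inord_0 addn0; exact: reach_refl.
have jK : 0 < j <= K by lia.
exact: (IH a.+1 (line x a.+1) jK erefl).
Qed.

(** The spare pebble [d] only has to lie in the base cell; its mark is arbitrary. *)
Definition semi_at (z : cell n * nat * S) (Z : pconf n carrier) := exists c b d,
  [/\ ctx_next c = z.2, d.1 = z.1.1 &
  Z = head_out (HHome b c) z.1.1 0 (place b (z.1.1, port0) (line z.1.1 z.1.2) d)].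

Lemma semi_init x c zB zD : zB.1 = x -> zD.1 = x ->
  exists2 Z, semi_at (x, 1, ctx_next c) Z &
    hrun (x, HInit c, place true (x, port0) zB zD) Z.
Proof.
move=> eB eD; eexists.
  by exists c, true, zD; split; [|exact: eD|reflexivity].
apply: reach_trans (@hrun_home (HHome true c) x 1 true _ _ _) =>
  [|g V p /negbTE /= -> //].
exists 2; rewrite /= carried_place !inE /= eB eqxx /=.
by rewrite /head_out /= obs_portsE.
Qed.

Section Macro.
Variables (x : cell n) (k : nat) (s : S) (b : bool).
Hypothesis k_gt0 : 0 < k.

Let w i : ctx := (s, obs x, inZp i).
Let num := ctx_num (w k).
Let den := ctx_den (w k).
Let y := hop L x (ctx_move (w k)).
Let N := k %/ den.

Lemma N_den : k = N * den.
Proof. by rewrite divnK // (den_dvdn op_ok). Qed.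

Lemma semi_walk zA zD :
  hrun (head_in (HWalk b (w 0)) x 0 (place b zA (line x k) zD))
       (head_out (HPull b true (w k) (inord den)) x k (place b zA (line x k) zD)).
Proof.
apply: reach_trans (@hrun_forth (fun i => HWalk b (w i)) x k _ _) _ => [i lt|].
  rewrite /= visible_place /= eqxx line_pair_eq gtn_eqF //.
  congr (_, _, _, HWalk _ (_, _) _); apply: val_inj => /=.
  by rewrite -addn1 modnDml addn1.
exists 1; rewrite /= /head_in /pstep /= visible_place /= eqxx line_pair_eq eqxx.
by [].
Qed.

Lemma semi_find a zA zD : 0 < a ->
  let pp := place b zA ((line x a).1, out (line x a)) zD in
  hrun (head_in (HFind b (w k)) x 0 pp)
       (head_out (HPull b false (w k) (inord den)) x a pp).
Proof.
move=> a0 pp.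
apply: reach_trans (@hrun_forth (fun=> HFind b (w k)) x a _ _) _ => [i lt|].
  rewrite /= visible_place /= eqxx; case: eqP => // -[e1 e2].
  have/(line_inj nc) e : line x a = line x i.
    apply: injective_projections => //.
    by move: e2; rewrite /out e1 => /(can_inj (nxtK hn _)).
  by rewrite e ltnn in lt.
by exists 1; rewrite /= /head_in /pstep /= visible_place /= !eqxx.
Qed.

Lemma semi_seek a zA zB :
  hrun (head_in (HSeek b (w k)) y 0 (place b zA zB (line y a)))
       (head_in (HPush b (w k) (inord num)) y a (place b zA zB (line y a))).
Proof.
have nb : (~~ b == b) = false by case: b.
apply: reach_trans (@hrun_forth (fun=> HSeek b (w k)) y a _ _) _ => [i lt|].
  by rewrite /= visible_place /= nb line_pair_eq gtn_eqF.
by exists 1; rewrite /= /head_in /pstep /= visible_place /= nb line_pair_eq eqxx.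
Qed.

(** The part of a round that serves the new tour. In the first round the spare pebble travels with
    the base mark and is pushed from index 0; later it must first be sought at index [a]. *)
Lemma semi_leg f a zB zD :
  (if f then zD.1 = x /\ a = 0 else zD = line y a) ->
  hrun (head_out (HRet b f (w k)) x 0 (place b (x, port0) zB zD))
       (head_out (HBack b (w k)) y 0 (place b (y, port0) zB (line y (a + num)))).
Proof.
move=> HD; have nK := num_bounds op_ok (w k).
apply: reach_trans (@hrun_home (HBack b (w k)) y (a + num) b _ _ _) =>
  [|g V p /negbTE /= -> //].
apply: (@reach_trans _ _
  (head_in (HPush b (w k) ord0) y (a + num)
     (place b (y, port0) zB (line y (a + num))))); last first.
  by exists 1; rewrite /= /head_in /pstep.
suff [zD' eD' r] : exists2 zD', zD'.1 = (line y a).1 &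
  hrun (head_out (HRet b f (w k)) x 0 (place b (x, port0) zB zD))
       (head_in (HPush b (w k) (inord num)) y a (place b (y, port0) zB zD')).
  exact: reach_trans r (hrun_push b (w k) _ _ nK eD').
have nb : (Some b == Some (~~ b) :> pebble) = false by case: b.
have V zB' zD' : (None, port0) \in visible x (place b (x, port0) zB' zD').
  by rewrite visible_place.
case: f HD => [[eD ->]|->].
  exists (if ctx_move (w k) is Some p then (leave L x p, port0) else zD).
    by rewrite /= /y; case: (ctx_move _).
  exists 1; rewrite /= /head_out /pstep /= V eqxx /= -/num /y.
  case: (ctx_move (w k)) => [p|] //=.
  by rewrite carried_place !inE /= eD nb !eqxx ?orbT.
exists (line y a) => //; apply: reach_trans (semi_seek a (y, port0) zB).
exists 1; rewrite /= /head_out /pstep /= V eqxx /= /y.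
case: (ctx_move (w k)) => [p|] //=.
by rewrite carried_place !inE /= !eqxx.
Qed.

Lemma semi_back zB zD :
  hrun (head_out (HBack b (w k)) y 0 (place b (y, port0) zB zD))
       (x, HCheck b (w k), place b (x, port0) zB zD).
Proof.
exists 1; rewrite /= /head_out /pstep /= visible_place /= !eqxx /= /y.
case: (ctx_move (w k)) => [p|] //=.
by rewrite carried_place !inE /= !eqxx /= obs_portsE leave_far.
Qed.

Lemma semi_done a zB : zB = ((line x 0).1, out (line x 0)) ->
  exists2 Z, semi_at (y, a, ctx_next (w k)) Z &
  hrun (x, HCheck b (w k), place b (x, port0) zB (line y a)) Z.
Proof.
move=> eB; pose zB' := if ctx_move (w k) is Some p then (leave L x p, port0) else zB.
exists (head_out (HHome (~~ b) (w k)) y 0 (place (~~ b) (y, port0) (line y a) zB')).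
  exists (w k), (~~ b), zB'; split=> //.
  by rewrite /zB' eB /= /y; case: (ctx_move _).
have nb : (Some (~~ b) == Some b :> pebble) = false by case: b.
exists 2; rewrite /= /pstep /= visible_place /= eqxx eB /out /= eqxx /=.
rewrite place_swap /zB' /y eB /head_out; case: (ctx_move (w k)) => [p|] //=.
by rewrite carried_place !inE /= nb !eqxx /=.
Qed.

(** The two claims treat the storage marked by its entry port, before the first pull, and by its
    port of departure, afterwards. *)
Lemma semi_fetch f a zD :
  hrun (head_out (HPull b f (w k) (inord den)) x (a + den)
          (place b (x, port0) (line x (a + den)) zD))
       (head_out (HRet b f (w k)) x 0
          (place b (x, port0) ((line x a).1, out (line x a)) zD)) /\
  hrun (head_out (HPull b f (w k) (inord den)) x (a + den)
          (place b (x, port0) ((line x (a + den)).1, out (line x (a + den))) zD))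
       (head_out (HRet b f (w k)) x 0
          (place b (x, port0) ((line x a).1, out (line x a)) zD)).
Proof.
have G zB : zB.1 = (line x (a + den)).1 ->
  hrun (head_out (HPull b f (w k) (inord den)) x (a + den) (place b (x, port0) zB zD))
       (head_out (HRet b f (w k)) x 0
          (place b (x, port0) ((line x a).1, out (line x a)) zD)).
  move=> eB; apply: reach_trans (hrun_pull b f (w k) _ _ (den_bounds op_ok (w k)) eB) _.
  apply: reach_trans (@hrun_home (HRet b f (w k)) x a b _ _ _) =>
    [|g V p /negbTE /= -> //].
  by exists 1; rewrite /= /head_out /pstep.
by split; apply: G.
Qed.

(** [r] counts the pulls still to come. The pull just made has not yet been matched by a push, hence
    [r.+1] pushes remain. *)
Lemma semi_loop r : forall f a zD,
  (if f then zD.1 = x /\ a = 0 else zD = line y a) ->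
  exists2 Z, semi_at (y, a + num * r.+1, ctx_next (w k)) Z &
  hrun (head_out (HRet b f (w k)) x 0 (place b (x, port0)
          ((line x (r * den)).1, out (line x (r * den))) zD)) Z.
Proof.
elim: r => [|r IH] f a zD HD.
  have [Z HZ run] := @semi_done (a + num) _ erefl.
  exists Z; first by rewrite muln1.
  exact: reach_trans (semi_leg _ HD) (reach_trans (semi_back _ _) run).
have [Z HZ run] := IH false (a + num) _ erefl; exists Z.
  by rewrite mulnS addnA.
apply: reach_trans (semi_leg _ HD) _; apply: reach_trans (semi_back _ _) _.
have -> : r.+1 * den = r * den + den by rewrite mulSnr.
apply: reach_trans run.
have [_] := semi_fetch false (r * den) (line y (a + num)).
apply: reach_trans; have d0 : 0 < r * den + den.
  by have := den_bounds op_ok (w k); rewrite -/den; lia.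
apply: reach_trans (semi_find (x, port0) _ d0).
(* [HCheck] must fail here: at a positive index the cell and port of departure differ from those at
   index 0. *)
exists 1; rewrite /= /pstep /= visible_place /= eqxx; case: eqP => // -[e1 e2].
have : line x (r * den + den) = line x 0.
  apply: injective_projections => //.
  by move: e2; rewrite /out e1 => /(can_inj (nxtK hn _)).
by move/(line_inj nc) => e; rewrite e in d0.
Qed.

Lemma mstep_den : mstep md op L (x, k, s) = (y, num * N, ctx_next (w k)).
Proof. by rewrite /N muln_divA ?(den_dvdn op_ok) // mulnC. Qed.

End Macro.

Lemma semi_simulation z Z : 0 < z.1.2 -> semi_at z Z ->
  exists2 Z', semi_at (mstep md op L z) Z' & hrun Z Z'.
Proof.
case: z => [[x k] s] k_gt0 [c [b [d [ec ed ->]]]].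
rewrite mstep_den //; have [d0 _] := andP (den_bounds op_ok (s, obs x, inZp k)).
have eN := N_den x s k_gt0; set N := k %/ _ in eN *.
have N0 : 0 < N by move: k_gt0; rewrite eN; case: N {eN}.
(* There are [N = k / den] rounds; the loop is entered after the first pull, with [N.-1] pulls
   left. *)
have [Z' HZ run] := @semi_loop x k s b k_gt0 N.-1 true 0 d (conj ed erefl).
exists Z'; first by rewrite add0n prednK in HZ.
apply: reach_step; rewrite /pstep /= visible_place /= !eqxx /= ec.
apply: reach_trans (@semi_walk x k s b (x, port0) d) _.
apply: reach_trans run; set den := ctx_den _ in eN d0 *.
have [] := @semi_fetch x k s b true (N.-1 * den) d.
by rewrite -mulSnr prednK // -eN.
Qed.
End Head.

(** * Running the walker on both teams *)

Section Exploration.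
Variables (n : nat) (hn : 0 < n).
Local Notation md := (walker_mod n).
Local Notation K := (5 ^ (2 * n).+1).
Local Notation op := (walker_op hn).

(* The initial counter value is 1, not 0, so the agents cannot start in a state
   of rest: they start at the end of an operation that leads to the start state
   of the walker. *)
Definition start_ctx : ctx n walker_state md :=
  ((true, true, (ord0, inord 1, ord_max)), [ffun=> port0 hn], inZp 1).

(** The residue 1 is not divisible by 2, so the operation is a turn, into the state with [dir] false
    from which [walker_visits] starts. *)
Lemma start_ctx_next :
  ctx_next op start_ctx = (true, false, (inord 1, ord0, ord_max)).
Proof.
rewrite /ctx_next /ctx_op /= modn_small // prednK ?expn_gt0 //.
by rewrite -{1}(expn0 30) ltn_exp2l.
Qed.

Variable L : labeling n.

Lemma start_visits c : exists2 z,
  reach (mstep md op L) (origin n, 1, ctx_next op start_ctx) z & z.1.1 = c.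
Proof.
have [w ew] := follow_surj hn L c.
have [|z r e] := @walker_visits n hn L (origin n) (origin n, 1, ctx_next op start_ctx) w.
  exists (inord 1), ord0, ord_max; rewrite start_ctx_next; split=> //.
  by rewrite /= !inE -!val_eqE /= inordK.
by exists z; rewrite // e.
Qed.

Hypothesis nc : no_port_cycle L.

Definition sync_start (i : 'I_3) : sync_state n walker_state md K :=
  if i == ord0 then SBase _ _ _ _
  else if i == inord 1 then SChase _ _ _ (port0 hn)
  else SRun start_ctx (inord (ctx_den op start_ctx)) (port0 hn).

Lemma sync_explores :
  explores L (@sync_delta n hn _ md K op) sync_start (@sync_sched 3).
Proof.
move=> c; have [z zr ez] := start_visits c.
have op_ok := walker_admissible hn.
have [T HT r] := @sync_init n hn _ md K op L nc op_ok (origin n) start_ctx.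
have [T' [c' [_ eT']] r'] := 
  mstep_simulation op_ok (sync_simulation nc op_ok) (z := (_, 1, _)) isT HT zr.
have [t et] := reach_trans r r'; exists t, ord0.
suff e : team_of (run L (@sync_delta n hn _ md K op) sync_start (@sync_sched 3) t) = T'.
  by rewrite -[LHS]/(team_of _).1.1.1 e eT'.
rewrite -et; elim: t {et} => [|t IH]; last by rewrite /= team_of_step IH.
by rewrite /team_of /= /sync_start -!val_eqE /= !inordK.
Qed.

Definition semi_start (i : 'I_4) : peb_state n (carrier n walker_state md K) :=
  if i == ord0 then inl (inl (HInit K start_ctx))
  else inr (if i == inord 1 then None else Some (i == inord 2), port0 hn).

Lemma semi_explores sched : fair sched ->
  explores L (peb_delta (@carrier_prog n hn _ md K op)) semi_start sched.
Proof.
move=> fs c; have [z zr ez] := start_visits c.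
have op_ok := walker_admissible hn.
pose o := (origin n, port0 hn).
have [Z HZ r] := @semi_init n hn _ md K op L nc (origin n) start_ctx o o erefl erefl.
have [Z' [c' [b [d [_ _ eZ']]]] r'] := 
  mstep_simulation op_ok (semi_simulation nc op_ok) (z := (_, 1, _)) isT HZ zr.
have [] := peb_reach fs (init := semi_start) (t := 0) _ (reach_trans r r').
  split=> //= i; rewrite ffunE /semi_start.
  by case: i => [[]|]; rewrite /= -!val_eqE /= !inordK.
move=> t [_ _ /(_ None)]; rewrite eZ' /= ffunE /= ez => -[e _].
by exists t, (inord 1).
Qed.
End Exploration.

Theorem theorem1p2 : forall n : nat, 0 < n ->
  (exists (Q : finType) (delta : transition n Q) (init : 'I_3 -> Q),
     forall L : labeling n, no_port_cycle L ->
       explores L delta init (@sync_sched 3)) /\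
  (exists (Q : finType) (delta : transition n Q) (init : 'I_4 -> Q),
     forall L : labeling n, no_port_cycle L ->
       forall sched : nat -> {set 'I_4}, fair sched ->
         explores L delta init sched).
Proof.
move=> n hn; split.
  eexists _, _, (sync_start hn) => L nc; exact: sync_explores.
eexists _, _, (semi_start hn) => L nc sched; exact: semi_explores.
Qed.
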